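(* Let $x\in\mathbb{R}^N$, $\eta_x>0$, and let $\phi:\mathbb{R}^N\to\mathbb{R}$ satisfy hypothesis (H) at $x$ with radius $\eta_x$, and assume $p_x\neq0$. Then for every $\epsilon\in(0,\eta_x)$ with $\epsilon|\nabla^2\phi(x)|\le|p_x|$: $$\Big|\mathcal{A}_\epsilon\phi(x)-\phi(x)-\frac{1}{c_s}\epsilon^{2s}\mathcal{L}_s[\phi](x)\Big|\le 2\epsilon^{2s}\Big(2sC_x\big(\eta_x^{2-2s}-\epsilon^{2-2s}\big)A_\epsilon+\Big(\frac{\eta_x^{-2s}}{2}+\frac{s\,\eta_x^{1-2s}}{2s-1}\Big)(1-s)\,\omega_\phi(A_\epsilon)\Big)+2s\epsilon^3\frac{|\nabla^2\phi(x)|^2}{|p_x|}+s\epsilon^2\sup_{y\in B_\epsilon(x)}|\nabla^2\phi(y)-\nabla^2\phi(x)|.$$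
   Context: Fix $N\ge1$ and $s\in(\frac12,1)$. Let $C_s=\frac{4^s s\,\Gamma(\frac12+s)}{\pi^{1/2}\Gamma(1-s)}$ and $c_s=\frac{C_s}{s(1-s)}$. Let $\mu_s$ be the Borel measure on $(0,\infty)$ with $\mathrm{d}\mu_s(t)=C_s t^{-1-2s}\,\mathrm{d}t$, and write $\fint_\epsilon^\infty g\,\mathrm{d}\mu_s=\frac{1}{\mu_s((\epsilon,\infty))}\int_\epsilon^\infty g\,\mathrm{d}\mu_s$. For $\phi:\mathbb{R}^N\to\mathbb{R}$ and $x,y,\tilde y\in\mathbb{R}^N$ let $L_\phi(x,y,\tilde y)=\phi(x+y)+\phi(x-\tilde y)-2\phi(x)$. Define $$\mathcal{L}_s[\phi](x)=\sup_{|y|=1}\inf_{|\tilde y|=1}\int_0^\infty L_\phi(x,ty,t\tilde y)\,\mathrm{d}\mu_s(t),$$ where $\int_0^\infty$ means $\lim_{\delta\to0^+}\int_\delta^\infty$ (a value in $[-\infty,\infty]$). Define $$\mathcal{A}_\epsilon^o\phi(x)=\frac12\Big(\sup_{|y|=1}\fint_\epsilon^\infty\phi(x+ty)\,\mathrm{d}\mu_s(t)+\inf_{|y|=1}\fint_\epsilon^\infty\phi(x+ty)\,\mathrm{d}\mu_s(t)\Big),\qquad \mathcal{A}_\epsilon\phi(x)=(1-s)\mathcal{A}_\epsilon^o\phi(x)+\frac{s}{2}\Big(\sup_{B_\epsilon(x)}\phi+\inf_{B_\epsilon(x)}\phi\Big).$$ Hypothesis (H) at $x$ with radius $\eta_x>0$: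 $\phi:\mathbb{R}^N\to\mathbb{R}$ is bounded and Borel; (i) $\phi\in C^2(\bar B_{\eta_x}(x))$, and we set $p_x=\nabla\phi(x)$, $C_x=\frac12\|\nabla^2\phi\|_{L^\infty(B_{\eta_x}(x))}$; (ii) $\phi$ is bounded and uniformly continuous on $\mathbb{R}^N\setminus\bar B_{\eta_x}(x)$, with modulus $\omega_\phi(a)=\sup\{|\phi(z)-\phi(w)|: z,w\in\mathbb{R}^N\setminus\bar B_{\eta_x}(x),\ |z-w|\le a\}$. $|\nabla^2\phi(\cdot)|$ denotes the operator norm of the Hessian. When $p_x\ne0$ and $0<\epsilon<\eta_x$ define $$\kappa_\epsilon=\sup\Big\{a\in[0,2]:\ a^2\le\frac{8\omega_\phi(a)}{|p_x|}\cdot\frac{\frac{2s-1}{2s}\eta_x^{-2s}+\eta_x^{1-2s}}{\epsilon^{1-2s}-\eta_x^{1-2s}}\Big\},\quad A_\epsilon=\max\Big\{\frac{16C_x}{|p_x|}\cdot\frac{2s-1}{1-s}\cdot\frac{\eta_x^{2-2s}-\epsilon^{2-2s}}{\epsilon^{1-2s}-\eta_x^{1-2s}},\ \kappa_\epsilon\Big\}.$$ *)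

(* Defs.v *)
From HB Require Import structures.
From mathcomp Require Import all_boot all_order all_algebra.
From mathcomp Require Import all_classical all_reals all_analysis.
Set Implicit Arguments. Unset Strict Implicit. Unset Printing Implicit Defensive.
Import Order.TTheory GRing.Theory Num.Theory.
Import numFieldNormedType.Exports.
Local Open Scope classical_set_scope.
Local Open Scope ring_scope.

Section Defs.
Variable R : realType.

Definition enorm (N : nat) (v : 'rV[R]_N) : R := Num.sqrt (\sum_(i < N) v ord0 i ^+ 2).

Definition eball (N : nat) (x : 'rV[R]_N) (r : R) : set 'rV[R]_N :=
  [set z | enorm (z - x) < r].
Definition ecball (N : nat) (x : 'rV[R]_N) (r : R) : set 'rV[R]_N :=
  [set z | enorm (z - x) <= r].

Definition opnorm (N : nat) (M : 'M[R]_N) : R :=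
  sup [set enorm (v *m M) | v in [set v : 'rV[R]_N | enorm v <= 1]].

Definition ebasis (N : nat) (i : 'I_N) : 'rV[R]_N := delta_mx ord0 i.

Definition grad (N : nat) (f : 'rV[R]_N -> R) (z : 'rV[R]_N) : 'rV[R]_N :=
  \row_i ('D_(ebasis i) f z).
Definition hess (N : nat) (f : 'rV[R]_N -> R) (z : 'rV[R]_N) : 'M[R]_N :=
  \matrix_(i, j) ('D_(ebasis j) ('D_(ebasis i) f) z).

Definition Gamma (z : R) : R :=
  fine (\int[lebesgue_measure]_(t in (`]0%R, +oo[ : set R)) (t `^ (z - 1) * expR (- t))%:E)%E.

Definition Cs (s : R) : R :=
  4 `^ s * s * Gamma (2^-1 + s) / (Num.sqrt pi * Gamma (1 - s)).
Definition cs (s : R) : R := Cs s / (s * (1 - s)).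

(* integral over (d, +oo) with respect to mu_s, dmu_s = C_s t^(-1-2s) dt *)
Definition mus_int (s d : R) (g : R -> R) : \bar R :=
  (\int[lebesgue_measure]_(t in (`]d, +oo[ : set R)) (g t * (Cs s * t `^ (-1 - 2 * s)))%:E)%E.

Definition mus_tail (s d : R) : R := fine (mus_int s d (fun=> 1)).

Definition mus_avg (s d : R) (g : R -> R) : R := fine (mus_int s d g) / mus_tail s d.

Definition Lphi (N : nat) (phi : 'rV[R]_N -> R) (x y yt : 'rV[R]_N) : R :=
  phi (x + y) + phi (x - yt) - 2 * phi x.

Definition mus_int0 (s : R) (g : R -> R) : \bar R :=
  lim (mus_int s ^~ g @ 0^'+).

Definition usphere (N : nat) : set 'rV[R]_N := [set y | enorm y = 1].

Definition Ls (N : nat) (s : R) (phi : 'rV[R]_N -> R) (x : 'rV[R]_N) : \bar R :=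
  ereal_sup [set ereal_inf [set mus_int0 s (fun t => Lphi phi x (t *: y) (t *: yt))
                           | yt in @usphere N]
            | y in @usphere N].

Definition Aeps_o (N : nat) (s eps : R) (phi : 'rV[R]_N -> R) (x : 'rV[R]_N) : R :=
  2^-1 * (sup [set mus_avg s eps (fun t => phi (x + t *: y)) | y in @usphere N]
        + inf [set mus_avg s eps (fun t => phi (x + t *: y)) | y in @usphere N]).

Definition Aeps (N : nat) (s eps : R) (phi : 'rV[R]_N -> R) (x : 'rV[R]_N) : R :=
  (1 - s) * Aeps_o s eps phi x
  + s / 2 * (sup (phi @` eball x eps) + inf (phi @` eball x eps)).

Definition omega (N : nat) (phi : 'rV[R]_N -> R) (x : 'rV[R]_N) (eta a : R) : R :=
  sup [set r : R | exists z w : 'rV[R]_N, [/\ ~ ecball x eta z, ~ ecball x eta w,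
        enorm (z - w) <= a & r = `|phi z - phi w|]].

Definition hypH (N : nat) (phi : 'rV[R]_N -> R) (x : 'rV[R]_N) (eta : R) : Prop :=
  [/\
      (exists M : R, forall z, `|phi z| <= M),
      (forall B : set R, measurable B ->
         smallest (sigma_algebra setT) [set U : set 'rV[R]_N | open U] (phi @^-1` B)),
      (* C^2 in the open ball, with phi, its gradient and Hessian extending
         continuously to the closed ball: phi in C^2(closed ball) *)
      [/\ (forall z, eball x eta z -> differentiable phi z),
          (forall i z, eball x eta z -> differentiable ('D_(ebasis i) phi) z),
          (forall i j z, eball x eta z ->
              {for z, continuous ('D_(ebasis j) ('D_(ebasis i) phi))}),
          {within ecball x eta, continuous phi} &
          [/\ exists g : 'rV[R]_N -> 'rV[R]_N,
                {within ecball x eta, continuous g} /\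
                (forall z, eball x eta z -> g z = grad phi z)
            & exists h : 'rV[R]_N -> 'M[R]_N,
                {within ecball x eta, continuous h} /\
                (forall z, eball x eta z -> h z = hess phi z)]] &
      (forall e : R, 0 < e -> exists d : R, 0 < d /\
         forall z w, ~ ecball x eta z -> ~ ecball x eta w ->
           enorm (z - w) <= d -> `|phi z - phi w| <= e)].

Definition Cx (N : nat) (phi : 'rV[R]_N -> R) (x : 'rV[R]_N) (eta : R) : R :=
  2^-1 * sup [set opnorm (hess phi z) | z in eball x eta].

Definition kappa (N : nat) (s : R) (phi : 'rV[R]_N -> R) (x : 'rV[R]_N) (eta eps : R) : R :=
  sup [set a : R | 0 <= a <= 2 /\
        a ^+ 2 <= 8 * omega phi x eta a / enorm (grad phi x) *
          (((2 * s - 1) / (2 * s) * eta `^ (- (2 * s)) + eta `^ (1 - 2 * s))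
           / (eps `^ (1 - 2 * s) - eta `^ (1 - 2 * s)))].

Definition Aeps_const (N : nat) (s : R) (phi : 'rV[R]_N -> R) (x : 'rV[R]_N) (eta eps : R) : R :=
  Num.max (16 * Cx phi x eta / enorm (grad phi x) * ((2 * s - 1) / (1 - s)) *
             ((eta `^ (2 - 2 * s) - eps `^ (2 - 2 * s))
              / (eps `^ (1 - 2 * s) - eta `^ (1 - 2 * s))))
          (kappa s phi x eta eps).

End Defs.

(* Main.v *)
(* Put v = p / |p|.  Since the weight t^(-2s) is not integrable at 0, a pair (y, y') of
   directions contributes a finite integral to L_s only if p.y = p.y', and the
   sup-inf is attained at y = y' = v, so that L_s[phi](x) is the integral of
   phi(x+tv) + phi(x-tv) - 2 phi(x).  Writing F(y) for the average of phi(x+ty), the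
   error splits into three parts.
   - sup F - F(v) and F(-v) - inf F.  For a unit y at distance d from v the
     linear part of phi loses |p| d^2 / 2 times the integral of t^(-2s) over (eps, eta),
     while the rest gains at most 2 Cx d t^2 inside the ball and
     2 (1+t) omega(d) outside (join x+ty to x+tv by a chain on the sphere of
     radius t); hence no gain once d > A_eps.
   - sup + inf of phi over B_eps, compared with its Taylor polynomial by completing
     the square.
   - the integral over (0, eps), compared with its second order expansion. *)

Require Import Defs.
From HB Require Import structures.
From mathcomp Require Import all_boot all_order all_algebra.
From mathcomp Require Import all_classical all_reals all_analysis.
From mathcomp Require Import measurable_realfun.
From mathcomp Require Import ring lra.
Set Implicit Arguments. Unset Strict Implicit. Unset Printing Implicit Defensive.
Import Order.TTheory GRing.Theory Num.Theory.
Import numFieldNormedType.Exports.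
Local Open Scope classical_set_scope.
Local Open Scope ring_scope.

(** * Euclidean geometry *)

(** The weights in [Aeps] make the error split exactly. Since [Cs s / cs s = s (1 - s)] and the tail
    of mu_s has mass [Cs s * eps^(-2s) / (2s)], the term (1-s)((F(v) + F(-v))/2 - phi(x)) is the
    normalized part of L_s over (eps, oo); and (s/2) eps^2 Hv.v, with H the Hessian at x, is both
    the second order value of the ball term and that of the part over (0, eps). The delicate
    comparison is that of directions. The loss is of order d^2, so each gain must vanish with d:
    phi(x+ty) is compared with phi(x+tv) directly, not each of them with phi(x). Outside the ball
    [omega] sees only pairs of points of the complement, and the segment from x+ty to x+tv may cross
    the ball; this forces the detour along a sphere. The first entry of A_eps is the distance beyond
    which the interior gain is at most 1/8 of the loss, and kappa the one beyond which the exterior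
    gain is at most half of it. *)

Section Euclid.
Context {R : realType} {N : nat}.
Implicit Types (u v w : 'rV[R]_N) (M : 'M[R]_N) (a : R).

Definition dot u v : R := \sum_(i < N) u ord0 i * v ord0 i.

Lemma dotC u v : dot u v = dot v u.
Proof. by apply: eq_bigr => i _; rewrite mulrC. Qed.

Lemma dotDl u v w : dot (u + v) w = dot u w + dot v w.
Proof. by rewrite -big_split/=; apply: eq_bigr => i _; rewrite mxE mulrDl. Qed.

Lemma dotDr u v w : dot u (v + w) = dot u v + dot u w.
Proof. by rewrite !(dotC u) dotDl. Qed.

Lemma dotZl a u w : dot (a *: u) w = a * dot u w.
Proof. by rewrite big_distrr/=; apply: eq_bigr => i _; rewrite mxE mulrA. Qed.

Lemma dotZr a u w : dot u (a *: w) = a * dot u w.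
Proof. by rewrite !(dotC u) dotZl. Qed.

Lemma dotNl u w : dot (- u) w = - dot u w.
Proof. by rewrite -scaleN1r dotZl mulN1r. Qed.

Lemma dotNr u w : dot u (- w) = - dot u w.
Proof. by rewrite !(dotC u) dotNl. Qed.

Definition dotE := (dotDl, dotDr, dotZl, dotZr, dotNl, dotNr).

Lemma dot0l v : dot 0 v = 0.
Proof. by rewrite -(scale0r 0) dotZl mul0r. Qed.

Lemma dot0r v : dot v 0 = 0.
Proof. by rewrite dotC dot0l. Qed.

Lemma dot_ge0 v : 0 <= dot v v.
Proof. by apply: sumr_ge0 => i _; rewrite -expr2 sqr_ge0. Qed.

Lemma dot_eq0 v : dot v v = 0 -> v = 0.
Proof.
move=> /eqP; rewrite psumr_eq0; last by move=> i _; rewrite -expr2 sqr_ge0.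
move=> /allP h; apply/rowP => i; rewrite mxE.
by have := h i (mem_index_enum _); rewrite /= -expr2 sqrf_eq0 => /eqP.
Qed.

Lemma enormE v : enorm v = Num.sqrt (dot v v).
Proof. by congr Num.sqrt; apply: eq_bigr => i _; rewrite expr2. Qed.

Lemma enorm_ge0 v : 0 <= enorm v.
Proof. exact: sqrtr_ge0. Qed.

Lemma sqr_enorm v : enorm v ^+ 2 = dot v v.
Proof. by rewrite enormE sqr_sqrtr// dot_ge0. Qed.

Lemma enorm_eq0 v : enorm v = 0 -> v = 0.
Proof. by move=> v0; apply: dot_eq0; rewrite -sqr_enorm v0 expr0n. Qed.

Lemma enorm0 : enorm (0 : 'rV[R]_N) = 0.
Proof. by rewrite enormE dot0l sqrtr0. Qed.

Lemma enorm_gt0 v : v != 0 -> 0 < enorm v.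
Proof.
move=> v0; rewrite lt_neqAle enorm_ge0 andbT eq_sym.
by apply: contra_neq v0; exact: enorm_eq0.
Qed.

Lemma enormZ a v : enorm (a *: v) = `|a| * enorm v.
Proof. by rewrite !enormE !dotE mulrA -expr2 sqrtrM ?sqr_ge0// sqrtr_sqr. Qed.

Lemma enormN v : enorm (- v) = enorm v.
Proof. by rewrite -scaleN1r enormZ normrN1 mul1r. Qed.

Lemma enormB u v : enorm (u - v) = enorm (v - u).
Proof. by rewrite -enormN opprB. Qed.

Lemma ler_dot u v : `|dot u v| <= enorm u * enorm v.
Proof.
have [->|v0] := eqVneq v 0; first by rewrite dot0r normr0 mulr_ge0 ?enorm_ge0.
have vv : 0 < dot v v by rewrite -sqr_enorm exprn_gt0// enorm_gt0.
rewrite -(@ler_pXn2r _ 2)// ?nnegrE ?mulr_ge0 ?enorm_ge0//.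
rewrite exprMn !sqr_enorm real_normK ?num_real//.
have := dot_ge0 (dot v v *: u - dot u v *: v).
rewrite !dotE (dotC v u) => h.
rewrite -subr_ge0 -(pmulr_rge0 _ vv); apply: le_trans h _.
by rewrite le_eqVlt; apply/orP; left; apply/eqP; ring.
Qed.

Lemma dot_le u v : dot u v <= enorm u * enorm v.
Proof. by apply: le_trans (ler_dot u v); rewrite ler_norm. Qed.

Lemma ler_enormD u v : enorm (u + v) <= enorm u + enorm v.
Proof.
rewrite -(@ler_pXn2r _ 2)// ?nnegrE ?addr_ge0 ?enorm_ge0//.
rewrite sqr_enorm !dotE (dotC v u) sqrrD !sqr_enorm.
have := dot_le u v; lra.
Qed.

Lemma ler_enorm_coord v i : `|v ord0 i| <= enorm v.
Proof.
rewrite -(@ler_pXn2r _ 2)// ?nnegrE ?enorm_ge0// real_normK ?num_real//.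
rewrite sqr_enorm /dot (bigD1 i)//= expr2 lerDl.
by apply: sumr_ge0 => j _; rewrite -expr2 sqr_ge0.
Qed.

Lemma mx_norm_le m n (A : 'M[R]_(m, n)) a :
  0 <= a -> (forall i j, `|A i j| <= a) -> `|A| <= a.
Proof.
move=> a0 h; rewrite [leLHS]/Num.norm/= mx_normrE.
by apply/bigmax_leP; split => // -[i j] _; exact: h.
Qed.

Lemma le_mx_norm m n (A : 'M[R]_(m, n)) i j : `|A i j| <= `|A|.
Proof.
rewrite [leRHS]/Num.norm/= mx_normrE; apply/bigmax_geP; right.
by exists (i, j).
Qed.

Lemma mx_norm_le_enorm v : `|v| <= enorm v.
Proof.
apply: mx_norm_le => [|i j]; first exact: enorm_ge0.
by rewrite ord1 ler_enorm_coord.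
Qed.

(** The library topology on row vectors is that of the sup norm; this bound and [mx_norm_le_enorm]
    move boundedness and continuity between it and the Euclidean norm. *)
Lemma enorm_le_mx_norm v : enorm v <= N%:R * `|v|.
Proof.
rewrite -(@ler_pXn2r _ 2)// ?nnegrE ?enorm_ge0 ?mulr_ge0//.
rewrite sqr_enorm /dot.
apply: (@le_trans _ _ (\sum_(i < N) `|v| ^+ 2)).
  apply: ler_sum => i _; rewrite -expr2 -real_normK ?num_real//.
  by rewrite ler_pXn2r ?nnegrE// le_mx_norm.
rewrite sumr_const card_ord -[leLHS]mulr_natl exprMn ler_wpM2r ?sqr_ge0//.
by rewrite -natrX ler_nat; case: (N) => // n; rewrite expnS leq_pmulr// expn_gt0.
Qed.

Lemma enorm_mulmx_le v M : enorm (v *m M) <= N%:R ^+ 2 * `|M| * enorm v.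
Proof.
apply: le_trans (enorm_le_mx_norm _) _.
rewrite expr2 -!mulrA ler_wpM2l//.
apply: mx_norm_le => [|i j]; first by rewrite !mulr_ge0 ?enorm_ge0.
rewrite !mxE; apply: le_trans (ler_norm_sum _ _ _) _.
apply: (@le_trans _ _ (\sum_(k < N) (`|M| * enorm v))).
  apply: ler_sum => k _; rewrite normrM mulrC ler_pM//; first exact: le_mx_norm.
  by rewrite ord1 ler_enorm_coord.
by rewrite sumr_const card_ord -[leLHS]mulr_natl.
Qed.

(** [sup] takes a default value on unbounded sets, so [opnorm] can be used only once this set is
    known to be nonempty and bounded. *)
Lemma opnorm_has_sup M :
  has_sup [set enorm (v *m M) | v in [set v : 'rV[R]_N | enorm v <= 1]].
Proof.
split; first by exists (enorm (0 *m M)), 0 => //=; rewrite enorm0.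
exists (N%:R ^+ 2 * `|M|) => _ [v /= v1 <-].
apply: le_trans (enorm_mulmx_le _ _) _.
by rewrite ler_piMr// mulr_ge0.
Qed.

Lemma opnorm_ge0 M : 0 <= opnorm M.
Proof.
apply: (@le_trans _ _ (enorm (0 *m M))); first exact: enorm_ge0.
apply: ub_le_sup; first by case: (opnorm_has_sup M).
by exists 0 => //=; rewrite enorm0.
Qed.

Lemma opnorm_le_mx_norm M : opnorm M <= N%:R ^+ 2 * `|M|.
Proof.
apply: ge_sup; first by case: (opnorm_has_sup M).
move=> _ [v /= v1 <-].
apply: le_trans (enorm_mulmx_le _ _) _.
by rewrite ler_piMr// mulr_ge0.
Qed.

Lemma enorm_mulmx_opnorm v M : enorm (v *m M) <= opnorm M * enorm v.
Proof.
have [->|v0] := eqVneq v 0; first by rewrite mul0mx enorm0 mulr0.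
have vp := enorm_gt0 v0.
rewrite -ler_pdivrMr//.
have -> : enorm (v *m M) / enorm v = enorm ((enorm v)^-1 *: v *m M).
  by rewrite -scalemxAl enormZ ger0_norm ?invr_ge0 ?enorm_ge0// mulrC.
apply: ub_le_sup; first by case: (opnorm_has_sup M).
exists ((enorm v)^-1 *: v) => //=.
by rewrite enormZ ger0_norm ?invr_ge0 ?enorm_ge0// mulVf// gt_eqF.
Qed.

Lemma ler_dot_mulmx v w M :
  `|dot (v *m M) w| <= opnorm M * enorm v * enorm w.
Proof.
apply: le_trans (ler_dot _ _) _.
by rewrite ler_wpM2r ?enorm_ge0// enorm_mulmx_opnorm.
Qed.

Lemma exists_orth_unit y : (1 < N)%N -> exists e, dot e e = 1 /\ dot y e = 0.
Proof.
move=> N1.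
suff [e [e0 ye]] : exists e, e != 0 /\ dot y e = 0.
  exists ((enorm e)^-1 *: e); rewrite !dotE ye mulr0; split => //.
  by rewrite -sqr_enorm expr2 mulKf ?mulVf// gt_eqF// enorm_gt0.
pose i0 := Ordinal (ltnW N1); pose i1 := Ordinal N1.
have i01 : i1 != i0 by [].
have dd u (i : 'I_N) : dot u (delta_mx ord0 i) = u ord0 i.
  rewrite /dot (bigD1 i)//= big1 ?addr0; first by rewrite mxE !eqxx mulr1.
  by move=> j /negbTE ji; rewrite mxE ji andbF mulr0.
have [y1|y1] := eqVneq (y ord0 i1) 0.
  exists (delta_mx ord0 i1); rewrite dd y1; split => //.
  by apply/eqP => /rowP /(_ i1) /eqP; rewrite !mxE !eqxx oner_eq0.
exists (y ord0 i1 *: delta_mx ord0 i0 - y ord0 i0 *: delta_mx ord0 i1).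
rewrite !dotE !dd mulrC subrr; split => //.
apply/eqP => /rowP /(_ i0) /eqP.
by rewrite !mxE/= mulr1 mulr0 subr0 (negbTE y1).
Qed.

(** Gram-Schmidt: th is the angle from y to v, and e the normalized component of v orthogonal to y.
    When v = y or v = -y that component vanishes and any orthogonal unit vector serves, which is
    where N > 1 enters. *)
Lemma sphere_polar y v : (1 < N)%N -> enorm y = 1 -> enorm v = 1 ->
  exists th e, [/\ 0 <= th <= pi, dot e e = 1, dot y e = 0 &
    v = cos th *: y + sin th *: e].
Proof.
move=> N1 y1 v1.
have yy : dot y y = 1 by rewrite -sqr_enorm y1 expr1n.
have vv : dot v v = 1 by rewrite -sqr_enorm v1 expr1n.
have cI : -1 <= dot y v <= 1.
  by rewrite -ler_norml (le_trans (ler_dot _ _))// y1 v1 mulr1.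
have r2 : dot (v - dot y v *: y) (v - dot y v *: y) = 1 - dot y v ^+ 2.
  by rewrite !dotE yy vv (dotC v y); ring.
have [/andP[th0 thpi] cth] := acos_def cI.
have sth := sin_acos cI.
have [r0|r0] := eqVneq (1 - dot y v ^+ 2) 0.
  have [e [ee ye]] := exists_orth_unit y N1.
  exists (acos (dot y v)), e; split => //; first by rewrite th0.
  rewrite cth sth r0 sqrtr0 scale0r addr0; apply/eqP; rewrite -subr_eq0.
  by apply/eqP/dot_eq0; rewrite r2.
have rp : 0 < 1 - dot y v ^+ 2 by rewrite lt_neqAle eq_sym r0 -r2 dot_ge0.
have sp : 0 < sin (acos (dot y v)) by rewrite sth sqrtr_gt0.
exists (acos (dot y v)), ((sin (acos (dot y v)))^-1 *: (v - dot y v *: y)).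
split; first by rewrite th0.
- rewrite dotZl dotZr r2 {1 2}sth -[X in _ * (_ * X)]sqr_sqrtr ?ltW//.
  by rewrite expr2 mulKf ?mulVf// -sth gt_eqF.
- by rewrite !dotE yy mulr1 subrr mulr0.
- by rewrite cth scalerA mulfV ?gt_eqF// scale1r addrC subrK.
Qed.

End Euclid.

(** * Angles and chords on the unit circle *)

Section TrigBounds.
Context {R : realType}.
Implicit Types h z : R.

Lemma sin_MVT z : 0 <= z -> exists2 c, 0 <= c <= z & sin z = cos c * z.
Proof.
move=> z0; have [c] := @MVT_segment R sin cos 0 z z0
  (fun x _ => is_derive_sin x) (continuous_subspaceT (@continuous_sin R)).
by rewrite in_itv/= sin0 !subr0 => cz sz; exists c.
Qed.

Lemma sqr_sin_le z : sin z ^+ 2 <= z ^+ 2.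
Proof.
wlog z0 : z / 0 <= z => [H|].
  have [/H//|/ltW z0] := leP 0 z.
  by rewrite -sqrrN -sinN -(sqrrN z) H// oppr_ge0.
have [c _ ->] := sin_MVT z0.
by rewrite exprMn ler_piMl ?sqr_ge0// -[leRHS](cos2Dsin2 c) lerDl sqr_ge0.
Qed.

Lemma cos_double h : cos h = 1 - 2 * sin (h / 2) ^+ 2.
Proof.
have -> : cos h = cos (h / 2 + h / 2) by rewrite -splitr.
by rewrite cosD -!expr2 cos2sin2; ring.
Qed.

Lemma one_minus_cos_le h : 2 - 2 * cos h <= h ^+ 2.
Proof. by rewrite cos_double; have := sqr_sin_le (h / 2); lra. Qed.

(* [sin z = 2 sin (z/2) cos (z/2)], [sin (z/2) >= (z/2) cos (z/2)] and
   [2 cos^2 (z/2) = 1 + cos z >= 1]. *)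
Lemma half_le_sin z : 0 <= z -> z <= (pi : R) / 2 -> z / 2 <= sin z.
Proof.
move=> z0 zpi.
have pi0 := pi_gt0 R.
have [c /andP[c0 cz] sz] := @sin_MVT (z / 2) ltac:(lra).
have cc : cos (z / 2) <= cos c.
  by rewrite leNgt ltr_cos ?in_itv/= -?leNgt//; apply/andP; split; lra.
have c0' : 0 <= cos (z / 2) by apply: cos_ge0_pihalf; apply/andP; split; lra.
have cz0 : 0 <= cos z by apply: cos_ge0_pihalf; apply/andP; split; lra.
have -> : sin z = 2 * sin (z / 2) * cos (z / 2).
  by rewrite {1}(splitr z) sinD; ring.
have cE : cos (z / 2) ^+ 2 = (1 + cos z) / 2.
  by rewrite cos2sin2 (cos_double z); field.
rewrite sz.
have -> : 2 * (cos c * (z / 2)) * cos (z / 2) = z * (cos c * cos (z / 2)) by field.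
rewrite ler_wpM2l//.
apply: (@le_trans _ _ (cos (z / 2) ^+ 2)); first by rewrite cE; lra.
by rewrite expr2 ler_wpM2r.
Qed.

(** The chord is d = 2 sin(th/2), and sin(th/2) >= th/4 because th/2 <= pi/2. *)
Lemma angle_le_chord (th d : R) : 0 <= th <= pi -> 0 <= d ->
  d ^+ 2 = 2 - 2 * cos th -> th <= 2 * d.
Proof.
move=> /andP[th0 thpi] d0 dE.
have s := @half_le_sin (th / 2) ltac:(lra) ltac:(lra).
rewrite -(@ler_pXn2r _ 2)// ?nnegrE ?mulr_ge0// exprMn dE cos_double.
have : (th / 2 / 2) ^+ 2 <= sin (th / 2) ^+ 2.
  by rewrite ler_pXn2r// nnegrE; [lra|apply: le_trans s; lra].
by rewrite !exprMn; lra.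
Qed.

End TrigBounds.

Section Arc.
Context {R : realType} {N : nat}.
Implicit Types (y v e : 'rV[R]_N).

Let arc y e a := cos a *: y + sin a *: e.

(* Two points of the sphere of radius [t] are joined along a great circle: the angle is
   at most twice the chord [d], so [ceil (2 t)] steps of length at most [d] suffice. *)
Lemma sphere_arc_chain y v (t : R) : (1 < N)%N -> enorm y = 1 -> enorm v = 1 ->
  0 < t -> exists (n : nat) (f : nat -> 'rV[R]_N),
  [/\ n%:R <= 2 * (1 + t), f 0%N = t *: y, f n = t *: v,
      forall k, enorm (f k) = t &
      forall k, enorm (f k - f k.+1) <= enorm (y - v)].
Proof.
move=> N1 y1 v1 t0.
have [th [e [thI ee ye vE]]] := sphere_polar N1 y1 v1.
have yy : dot y y = 1 by rewrite -sqr_enorm y1 expr1n.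
have ey : dot e y = 0 by rewrite dotC.
have dE : enorm (y - v) ^+ 2 = 2 - 2 * cos th.
  rewrite sqr_enorm vE !dotE yy ee ye ey.
  rewrite -[in RHS](cos2Dsin2 th).
  by transitivity (1 + (cos th ^+ 2 + sin th ^+ 2) - 2 * cos th); [ring|rewrite cos2Dsin2; ring].
have thd := angle_le_chord thI (enorm_ge0 _) dE.
(* The successor of the floor of 2t is positive, exceeds 2t and is at most 1 + 2t. *)
pose n := (Num.truncn (2 * t)).+1.
have n0 : 0 < n%:R :> R by rewrite ltr0n.
have nlt : 2 * t < n%:R by rewrite -truncn_lt_nat ?mulr_ge0 ?ltW//.
have nle : n%:R <= 2 * (1 + t).
  have h : (Num.truncn (2 * t))%:R <= 2 * t by rewrite truncn_le mulr_ge0// ltW.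
  by rewrite /n -natr1; lra.
(* The points run on past n along the same circle, so both bounds hold for every k. *)
pose f (k : nat) := t *: arc y e (k%:R * (th / n%:R)).
exists n, f; split => //.
- by rewrite /f /arc mul0r cos0 sin0 scale0r addr0 scale1r.
- by rewrite /f /arc vE mulrCA mulfV ?gt_eqF// mulr1.
- move=> k; rewrite /f enormZ gtr0_norm// enormE /arc !dotE yy ee ye ey.
  rewrite !(mulr1, mulr0, addr0, add0r) -!expr2 cos2Dsin2 sqrtr1 mulr1//.
- move=> k; rewrite /f -scalerBr enormZ gtr0_norm//.
  set a := k%:R * _; set b := k.+1%:R * _.
  (* The chord of one step is at most its angle th/n. Scaled by t it is at most 2 t d / n with d =
     |y - v|, hence at most d since 2t < n. *)
  have ab : enorm (arc y e a - arc y e b) <= th / n%:R.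
    rewrite -(@ler_pXn2r _ 2)// ?nnegrE ?enorm_ge0//; last first.
      by case/andP: thI => ? _; rewrite divr_ge0.
    have -> : enorm (arc y e a - arc y e b) ^+ 2 = 2 - 2 * cos (a - b).
      rewrite sqr_enorm /arc !dotE yy ee ye ey cosB.
        transitivity ((cos a ^+ 2 + sin a ^+ 2) + (cos b ^+ 2 + sin b ^+ 2)
        - 2 * (cos a * cos b + sin a * sin b)); first ring.
      by rewrite !cos2Dsin2; ring.
    apply: le_trans (one_minus_cos_le _) _.
    by rewrite /a /b -natr1 mulrDl mul1r opprD addNKr sqrrN.
  apply: (@le_trans _ _ (t * (th / n%:R))); first by rewrite ler_wpM2l// ltW.
  rewrite mulrA ler_pdivrMr//.
  apply: (@le_trans _ _ (t * (2 * enorm (y - v)))); first by rewrite ler_wpM2l// ltW.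
  rewrite mulrCA mulrA (mulrC _ n%:R) ler_wpM2r ?enorm_ge0// ltW//.
Qed.

End Arc.

(** * The weighted integral *)

Section PowerIntegrals.
Context {R : realType}.
Implicit Types a b d q r t : R.
Local Notation leb := (@lebesgue_measure R).

Lemma powR_cvg_pinfty r : 0 < r -> t `^ (- r) @[t --> +oo] --> (0 : R).
Proof.
move=> r0; apply/cvgr0Pnorm_lt => e e0.
near=> t.
have t0 : 0 < t by near: t; exact: nbhs_pinfty_gt.
have te : (e^-1) `^ (r^-1) < t by near: t; exact: nbhs_pinfty_gt.
rewrite ger0_norm ?powR_ge0// powRN -(invrK e) ltf_pV2 ?posrE ?powR_gt0 ?invr_gt0//.
have -> : e^-1 = (e^-1 `^ r^-1) `^ r.
  by rewrite -powRrM mulVf ?gt_eqF// powRr1// invr_ge0 ltW.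
by rewrite gt0_ltr_powR// nnegrE ?powR_ge0// ltW.
Unshelve. all: by end_near. Qed.

Lemma is_derive_powR_div q t : q != 0 -> 0 < t ->
  is_derive t 1 (fun u : R => u `^ q / q) (t `^ (q - 1)).
Proof.
move=> q0 t0.
have -> : (fun u => u `^ q / q) = (q^-1 \*: (fun u : R => u `^ q : R)).
  by apply/funext => u; rewrite /GRing.scale/= mulrC.
apply: is_derive_eq; first exact/is_deriveZ/is_derive1_powR.
by rewrite /GRing.scale/= mulKf.
Qed.

Lemma continuous_powR_div q t : q != 0 -> 0 < t ->
  {for t, continuous (fun u : R => u `^ q / q)}.
Proof.
move=> q0 t0; apply: differentiable_continuous; apply/derivable1_diffP.
by have [] := is_derive_powR_div q0 t0.
Qed.

Lemma derivable_powR_gt0 q t : 0 < t -> derivable (fun u : R => u `^ q) t 1.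
Proof. by move=> t0; apply: derivable_powR; rewrite in_itv/= t0. Qed.

Lemma continuous_powR_gt0 q t : 0 < t -> {for t, continuous (fun u : R => u `^ q)}.
Proof.
by move=> t0; apply: differentiable_continuous; apply/derivable1_diffP/derivable_powR_gt0.
Qed.

Lemma measurable_powR_EFin q (D : set R) :
  measurable_fun D (fun t : R => (t `^ q)%:E).
Proof.
by apply: measurable_funTS; apply/measurable_EFinP; exact: measurable_powR.
Qed.

Lemma integral_powR_itv a b q : 0 < a -> a < b -> q != 0 ->
  (\int[leb]_(t in `]a, b]) (t `^ (q - 1))%:E = ((b `^ q - a `^ q) / q)%:E)%E.
Proof.
move=> a0 ab q0.
rewrite integral_itv_obnd_cbnd; last exact: measurable_powR_EFin.
have cF t := @continuous_powR_div q t q0.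
rewrite (@continuous_FTC2 _ _ (fun u => u `^ q / q))//.
- by rewrite -EFinB -mulrBl.
- apply: continuous_in_subspaceT => t; rewrite inE/= in_itv/= => /andP[at_ _].
  by apply: continuous_powR_gt0; exact: lt_le_trans at_.
- split.
  + move=> t; rewrite in_itv/= => /andP[at_ _].
    by have [] := is_derive_powR_div q0 (lt_trans a0 at_).
  + by apply: cvg_at_right_filter; exact: cF.
  + by apply: cvg_at_left_filter; apply: cF; exact: lt_trans ab.
- move=> t; rewrite in_itv/= => /andP[at_ _]; rewrite derive1E.
  by have [_ ->] := is_derive_powR_div q0 (lt_trans a0 at_).
Qed.

Lemma integral_powR_tail d r : 0 < d -> 0 < r ->
  (\int[leb]_(t in `]d, +oo[) (t `^ (- r - 1))%:E = (d `^ (- r) / r)%:E)%E.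
Proof.
move=> d0 r0.
have nr0 : - r != 0 by rewrite oppr_eq0 gt_eqF.
rewrite integral_itv_obnd_cbnd; last exact: measurable_powR_EFin.
rewrite (@ge0_continuous_FTC2y _ _ (fun u => u `^ (- r) / (- r)) _ 0)//.
- by rewrite -EFinB sub0r invrN mulrN opprK.
- by move=> t _; exact: powR_ge0.
- apply: continuous_in_subspaceT => t; rewrite inE/= in_itv/= andbT => dt.
  by apply: continuous_powR_gt0; exact: lt_le_trans dt.
- rewrite -[X in _ --> X](mul0r (- r)^-1).
  by apply: cvgM; [exact: powR_cvg_pinfty|exact: cvg_cst].
- by move=> t dt; have [] := is_derive_powR_div nr0 (lt_trans d0 dt).
- apply: cvg_at_right_filter.
  exact: continuous_powR_div.
- move=> t; rewrite in_itv/= andbT => dt; rewrite derive1E.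
  by have [_ ->] := is_derive_powR_div nr0 (lt_trans d0 dt).
Qed.

Lemma integrable_powR_of_integral q (D : set R) (v : R) : measurable D ->
  (\int[leb]_(t in D) (t `^ q)%:E = v%:E)%E ->
  leb.-integrable D (EFin \o (fun t : R => t `^ q)).
Proof.
move=> mD E; apply/integrableP; split; first exact: measurable_powR_EFin.
under eq_integral do rewrite gee0_abs ?lee_fin ?powR_ge0//.
by rewrite E ltry.
Qed.

(** For q < 1 the integrand is unbounded at 0: the bound 1/q holds on every truncated interval and
    passes to their union by monotone convergence. *)
Lemma integral_powR01_lty q : 0 < q ->
  (\int[leb]_(t in `]0%R, 1%R]) (t `^ (q - 1))%:E < +oo)%E.
Proof.
move=> q0.
(* [n.+2] puts the left end strictly below 1, as [integral_powR_itv] requires. *)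
pose F (n : nat) : set R := `](n.+2%:R^-1)%R, 1%R]%classic.
have -> : `]0%R, 1%R]%classic = \bigcup_n F n.
  apply/seteqP; split => [t|t [n _]]; rewrite /F/= !in_itv/=.
    move=> /andP[t0 t1]; exists (Num.truncn t^-1) => //=.
    rewrite in_itv/= t1 andbT invf_plt ?posrE//.
    rewrite -truncn_lt_nat ?invr_ge0 ?ltW//.
  move=> /andP[nt ->]; rewrite andbT (lt_trans _ nt)// invr_gt0.
have mF n : measurable (F n) by exact: measurable_itv.
have H : (\int[leb]_(t in F n) (t `^ (q - 1))%:E @[n --> \oo] -->
    \int[leb]_(t in \bigcup_n F n) (t `^ (q - 1))%:E)%E.
  apply: ge0_nondecreasing_set_cvg_integral => //.
  - move=> m n mn; apply/subsetPset => t; rewrite /F/= !in_itv/= => /andP[mt ->].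
    by rewrite andbT (le_lt_trans _ mt)// lef_pV2 ?posrE ?ltr0n// ler_nat !ltnS.
  - by move=> n; exact: measurable_powR_EFin.
  - by move=> n t _; rewrite lee_fin powR_ge0.
apply: (@le_lt_trans _ _ (q^-1)%:E); last by rewrite ltry.
rewrite -(cvg_lim _ H)//; apply: lime_le; first by apply/cvg_ex; eexists; exact: H.
apply: nearW => n; rewrite integral_powR_itv ?gt_eqF//; last first.
  by rewrite invf_lt1// ltr1n.
by rewrite lee_fin powR1 ler_pdivrMr// mulVf ?gt_eqF// gerBl powR_ge0.
Qed.

End PowerIntegrals.

(** * Finiteness and positivity of the Gamma integral *)

Section GammaPositivity.
Context {R : realType}.
Implicit Types t z : R.
Local Notation leb := (@lebesgue_measure R).

Let gamma_fun z t := t `^ (z - 1) * expR (- t).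

Let measurable_gamma_fun z (D : set R) :
  measurable_fun D (fun t : R => (gamma_fun z t)%:E).
Proof.
apply: measurable_funTS; apply/measurable_EFinP; apply: measurable_funM.
  exact: measurable_powR.
by apply: measurableT_comp => //; exact: measurable_expR.
Qed.

Let gamma_fun_ge0 z t : (0 <= (gamma_fun z t)%:E)%E.
Proof. by rewrite lee_fin mulr_ge0 ?powR_ge0 ?expR_ge0. Qed.

(** The exponential series gives e^t >= t^3/3!. The cube leaves the integrable t^(-2) when t^(z-1)
    <= t in the tail of [Gamma]. *)
Lemma expRN_le_cube t : 0 < t -> expR (- t) <= 6 * t ^- 3.
Proof.
move=> t0; rewrite expRN -[leRHS]invrK lef_pV2 ?posrE ?expR_gt0//; last first.
  by rewrite invr_gt0 mulr_gt0// invr_gt0 exprn_gt0.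
apply: le_trans (expR_ge1Dxn 2 (ltW t0)).
rewrite invfM invrK mulrC lerDr ler01//.
Qed.

(** [Gamma] is [fine] of an extended integral, hence 0 if that integral diverges: besides a lower
    bound, taken on ]1, 2], finiteness must be shown, separately below and above 1. The range of z
    contains both 1/2 + s and 1 - s. *)
Lemma Gamma_gt0 z : 0 < z -> z <= 2 -> 0 < Gamma z.
Proof.
move=> z0 z2; apply: fine_gt0.
change (0 < \int[leb]_(t in `]0%R, +oo[) (gamma_fun z t)%:E < +oo)%E.
have mI (i : interval R) : measurable [set` i] by exact: measurable_itv.
apply/andP; split.
- have c0 : 0 < 2^-1 * expR (- 2) :> R by rewrite mulr_gt0// ?invr_gt0// expR_gt0.
  apply: (@lt_le_trans _ _ (\int[leb]_(t in `]1%R, 2%R]) (2^-1 * expR (- 2))%:E)%E).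
    rewrite integral_cst//= lebesgue_measure_itv/= lte_fin ltr1n -EFinB -EFinM lte_fin.
    by rewrite mulr_gt0//; lra.
  apply: (@le_trans _ _ (\int[leb]_(t in `]1%R, 2%R]) (gamma_fun z t)%:E)%E).
    apply: ge0_le_integral => //.
    + exact: measurable_gamma_fun.
    + move=> t /=; rewrite in_itv/= => /andP[t1 tle2]; rewrite lee_fin ler_pM ?expR_ge0//.
        have tp : 0 < t by exact: lt_trans t1.
        apply: (@le_trans _ _ (t `^ (-1))).
          by rewrite (powR_inv1 (ltW tp)) lef_pV2 ?posrE.
        by rewrite ler_powR ?(ltW t1)//; lra.
      by rewrite ler_expR lerN2.
  apply: ge0_subset_integral => //; first exact: measurable_gamma_fun.
  move=> t /=; rewrite !in_itv/= andbT => /andP[t1 _].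
  exact: lt_trans t1.
- have -> : `]0%R, +oo[%classic = `]0%R, 1%R] `|` `]1%R, +oo[ :> set R.
    by rewrite -itv_bndbnd_setU// bnd_simp.
  rewrite ge0_integral_setU//=; last 2 first.
    exact: measurable_gamma_fun.
    apply/disj_setPS => t [/=]; rewrite !in_itv/= andbT => /andP[_ t1].
    by rewrite ltNge t1.
  apply: lte_add_pinfty.
    apply: le_lt_trans (integral_powR01_lty z0).
    apply: ge0_le_integral => //.
    + exact: measurable_gamma_fun.
    + exact: measurable_powR_EFin.
    + move=> t /=; rewrite in_itv/= => /andP[t0 t1]; rewrite lee_fin.
      by rewrite ler_piMr ?powR_ge0// expR_le1 oppr_le0 ltW.
  apply: (@le_lt_trans _ _ (\int[leb]_(t in `]1%R, +oo[) (6%:E * (t `^ (- 1 - 1))%:E))%E).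
    apply: ge0_le_integral => //.
    + exact: measurable_gamma_fun.
    + by apply: measurable_funeM; exact: measurable_powR_EFin.
    + move=> t /=; rewrite in_itv/= andbT => t1; rewrite -EFinM lee_fin.
      have t0 : 0 < t by exact: lt_trans t1.
      apply: (@le_trans _ _ (t * (6 * t ^- 3))).
        apply: ler_pM; rewrite ?powR_ge0 ?expR_ge0 ?expRN_le_cube//.
        by rewrite -[leRHS](powRr1 (ltW t0)) ler_powR ?(ltW t1)//; lra.
      have -> : - 1 - 1 = - 2%:R :> R by lra.
      rewrite (powR_invn _ (ltW t0)) mulrCA ler_wpM2l// !exprS.
      rewrite expr0 mulr1 le_eqVlt; apply/orP; left; apply/eqP; field.
      by rewrite gt_eqF.
  rewrite ge0_integralZl//; last 2 first.
    exact: measurable_powR_EFin.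
    by move=> t _; rewrite lee_fin powR_ge0.
  by rewrite integral_powR_tail// -EFinM ltry.
Qed.

Lemma Cs_gt0 (s : R) : 2^-1 < s -> s < 1 -> 0 < Cs s.
Proof.
move=> s2 s1; have s0 : 0 < s by apply: lt_trans s2; rewrite invr_gt0.
rewrite /Cs divr_gt0//.
  by rewrite !mulr_gt0 ?powR_gt0// Gamma_gt0//; lra.
by rewrite mulr_gt0 ?sqrtr_gt0 ?pi_gt0// Gamma_gt0//; lra.
Qed.

End GammaPositivity.

Section Weight.
Context {R : realType}.
Variable s : R.
Hypothesis s_gt : 2^-1 < s.
Hypothesis s_lt : s < 1.
Implicit Types (a b c d e t K M : R) (g : R -> R) (D : set R).
Local Notation leb := (@lebesgue_measure R).

Let s0 : 0 < s. Proof. by apply: lt_trans s_gt; rewrite invr_gt0. Qed.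
Let s21 : 0 < 2 * s - 1. Proof. by have := s_gt; lra. Qed.
Let s22 : 0 < 2 - 2 * s. Proof. by have := s_lt; lra. Qed.
Let mitv (i : interval R) : measurable [set` i] := measurable_itv i.

Let wt t := t `^ (-1 - 2 * s).

Let measurable_wt : measurable_fun [set: R] wt.
Proof. exact: measurable_powR. Qed.

(* Integration against [t^(-1-2s) dt], that is [mu_s] without its constant [C_s]. *)
Definition wintegrable D g := leb.-integrable D (EFin \o (fun t => g t * wt t)).
Definition wint D g : R := (\int[leb]_(t in D) (g t * wt t))%R.

Let id_wt t : 0 < t -> t * wt t = t `^ (- (2 * s - 1) - 1).
Proof.
move=> t0; rewrite -[X in X * _](powRr1 (ltW t0)) -powRD; last first.
  by rewrite (gt_eqF t0) implybT.
by congr powR; ring.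
Qed.

(** The exponent in the form [q - 1] of [integral_powR_itv], where [id_wt] has the form [- r - 1] of
    [integral_powR_tail]. *)
Let id_wt' t : 0 < t -> t * wt t = t `^ ((1 - 2 * s) - 1).
Proof. by move=> t0; rewrite id_wt//; congr powR; ring. Qed.

Let sq_wt t : 0 < t -> t ^+ 2 * wt t = t `^ ((2 - 2 * s) - 1).
Proof.
move=> t0; rewrite -(powR_mulrn _ (ltW t0)) -powRD; last by rewrite (gt_eqF t0) implybT.
by congr powR; ring.
Qed.

Let wint_of_powR D g p v : measurable D -> (forall t, D t -> g t * wt t = t `^ p) ->
  (\int[leb]_(t in D) (t `^ p)%:E = v%:E)%E -> wintegrable D g /\ wint D g = v.
Proof.
move=> mD E V.
have E' : {in D, EFin \o (fun t => t `^ p) =1 EFin \o (fun t => g t * wt t)}.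
  by move=> t; rewrite inE => /E/= ->.
split.
  rewrite /wintegrable; apply: (@eq_integrable _ _ _ leb D mD _ _ E').
  exact: (integrable_powR_of_integral mD V).
have /= EI := @eq_integral _ _ _ leb D _ _ E'.
by rewrite V in EI; rewrite /wint /Rintegral -EI.
Qed.

Lemma wint_tail1 d : 0 < d ->
  wintegrable `]d, +oo[ (fun=> 1) /\ wint `]d, +oo[ (fun=> 1) = d `^ (- (2 * s)) / (2 * s).
Proof.
move=> d0; apply: (@wint_of_powR _ _ (- (2 * s) - 1)) => //.
  by move=> t _; rewrite mul1r /wt addrC.
by apply: integral_powR_tail => //; rewrite mulr_gt0.
Qed.

Lemma wint_tail_id d : 0 < d ->
  wintegrable `]d, +oo[ id /\ wint `]d, +oo[ id = d `^ (1 - 2 * s) / (2 * s - 1).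
Proof.
move=> d0; have -> : 1 - 2 * s = - (2 * s - 1) by ring.
apply: (@wint_of_powR _ _ (- (2 * s - 1) - 1)) => //; last exact: integral_powR_tail.
by move=> t /=; rewrite in_itv/= andbT => dt; rewrite id_wt// (lt_trans d0).
Qed.

Lemma wint_itv_id a b : 0 < a -> a < b -> wintegrable `]a, b] id /\
  wint `]a, b] id = (a `^ (1 - 2 * s) - b `^ (1 - 2 * s)) / (2 * s - 1).
Proof.
move=> a0 ab.
have -> : (a `^ (1 - 2 * s) - b `^ (1 - 2 * s)) / (2 * s - 1) =
    (b `^ (1 - 2 * s) - a `^ (1 - 2 * s)) / (1 - 2 * s).
  by field; rewrite -(opprB (2 * s)) oppr_eq0 gt_eqF.
apply: (@wint_of_powR _ _ ((1 - 2 * s) - 1)) => //.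
  by move=> t /=; rewrite in_itv/= => /andP[dt _]; rewrite id_wt'// (lt_trans a0).
by apply: integral_powR_itv => //; rewrite -(opprB (2 * s)) oppr_eq0 gt_eqF.
Qed.

Lemma wint_itv_sq a b : 0 < a -> a < b -> wintegrable `]a, b] (fun t => t ^+ 2) /\
  wint `]a, b] (fun t => t ^+ 2) =
    (b `^ (2 - 2 * s) - a `^ (2 - 2 * s)) / (2 - 2 * s).
Proof.
move=> a0 ab; apply: (@wint_of_powR _ _ ((2 - 2 * s) - 1)) => //.
  by move=> t /=; rewrite in_itv/= => /andP[dt _]; rewrite sq_wt// (lt_trans a0).
by apply: integral_powR_itv => //; rewrite gt_eqF.
Qed.

Lemma wintegrableD D g1 g2 : measurable D -> wintegrable D g1 -> wintegrable D g2 ->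
  wintegrable D (fun t => g1 t + g2 t).
Proof.
move=> mD i1 i2; rewrite /wintegrable.
have -> : EFin \o (fun t => (g1 t + g2 t) * wt t) =
   (EFin \o (fun t => g1 t * wt t)) \+ (EFin \o (fun t => g2 t * wt t)) :> (R -> \bar R).
  by apply/funext => t /=; rewrite mulrDl.
exact: integrableD.
Qed.

Lemma wintD D g1 g2 : measurable D -> wintegrable D g1 -> wintegrable D g2 ->
  wint D (fun t => g1 t + g2 t) = wint D g1 + wint D g2.
Proof.
move=> mD i1 i2; rewrite /wint -RintegralD//.
by apply: eq_Rintegral => t _; rewrite mulrDl.
Qed.

Lemma wintegrableZ D c g : measurable D -> wintegrable D g ->
  wintegrable D (fun t => c * g t).
Proof.
move=> mD i1; rewrite /wintegrable.
have -> : EFin \o (fun t => c * g t * wt t) =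
   (fun t => (c%:E * (g t * wt t)%:E)%E) :> (R -> \bar R).
  by apply/funext => t /=; rewrite -EFinM mulrA.
exact: (@integrableZl _ _ _ leb D mD c _ i1).
Qed.

Lemma wintZ D c g : measurable D -> wintegrable D g ->
  wint D (fun t => c * g t) = c * wint D g.
Proof.
move=> mD i1; rewrite /wint -RintegralZl//.
by apply: eq_Rintegral => t _; rewrite mulrA.
Qed.

Lemma wint_le D g1 g2 : measurable D -> wintegrable D g1 -> wintegrable D g2 ->
  (forall t, D t -> g1 t <= g2 t) -> wint D g1 <= wint D g2.
Proof.
move=> mD i1 i2 h; apply: le_Rintegral => // t Dt.
by rewrite ler_wpM2r ?powR_ge0// h.
Qed.

Lemma wintegrableS D1 D2 g : measurable D1 -> measurable D2 -> D2 `<=` D1 ->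
  wintegrable D1 g -> wintegrable D2 g.
Proof. by move=> m1 m2 h; exact: integrableS. Qed.

(** Away from 0 the weight has finite mass, so the constant M dominates. *)
Lemma wintegrable_bounded d M g : 0 < d -> measurable_fun [set: R] g ->
  (forall t, `|g t| <= M) -> wintegrable `]d, +oo[ g.
Proof.
move=> d0 mg gM.
have [i1 _] := wint_tail1 d0.
have iM := wintegrableZ M (mitv _) i1.
apply: le_integrable iM => //.
  apply: measurable_funTS; apply/measurable_EFinP.
  by apply: measurable_funM => //; exact: measurable_wt.
move=> t _ /=; rewrite mulr1 lee_fin !normrM ler_wpM2r//.
by rewrite (le_trans (gM t))// ler_norm.
Qed.

Lemma wint_split d b g : d <= b -> wintegrable `]d, +oo[ g ->
  wint `]d, +oo[ g = wint `]d, b] g + wint `]b, +oo[ g.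
Proof.
move=> db i; rewrite /wint -(Rintegral_itvB (x := b) i) ?bnd_simp//; lra.
Qed.

Lemma wint_itv_poly a b (c1 c2 : R) : 0 < a -> a < b ->
  wintegrable `]a, b] (fun t => c1 * t + c2 * t ^+ 2) /\
  wint `]a, b] (fun t => c1 * t + c2 * t ^+ 2) =
    c1 * ((a `^ (1 - 2 * s) - b `^ (1 - 2 * s)) / (2 * s - 1)) +
    c2 * ((b `^ (2 - 2 * s) - a `^ (2 - 2 * s)) / (2 - 2 * s)).
Proof.
move=> a0 ab.
have [i1 e1] := wint_itv_id a0 ab; have [i2 e2] := wint_itv_sq a0 ab.
have i1' := wintegrableZ c1 (mitv _) i1; have i2' := wintegrableZ c2 (mitv _) i2.
split; first exact: wintegrableD.
by rewrite wintD// !wintZ// e1 e2.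
Qed.

Lemma wint_tail_affine d (c1 c2 : R) : 0 < d ->
  wintegrable `]d, +oo[ (fun t => c1 * 1 + c2 * t) /\
  wint `]d, +oo[ (fun t => c1 * 1 + c2 * t) =
    c1 * (d `^ (- (2 * s)) / (2 * s)) + c2 * (d `^ (1 - 2 * s) / (2 * s - 1)).
Proof.
move=> d0.
have [i1 e1] := wint_tail1 d0; have [i2 e2] := wint_tail_id d0.
have i1' := wintegrableZ c1 (mitv _) i1; have i2' := wintegrableZ c2 (mitv _) i2.
split; first exact: wintegrableD.
by rewrite wintD// !wintZ// e1 e2.
Qed.

Lemma mus_intE d g : wintegrable `]d, +oo[ g ->
  mus_int s d g = (Cs s * wint `]d, +oo[ g)%:E.
Proof.
move=> i; rewrite /mus_int /wint /Rintegral.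
transitivity (\int[leb]_(t in `]d, +oo[) ((Cs s)%:E * (g t * wt t)%:E))%E.
  by apply: eq_integral => t _; rewrite -EFinM mulrCA.
rewrite integralZl// [RHS]EFinM; congr (_ * _)%E.
by rewrite fineK//; exact: integrable_fin_num.
Qed.

(** The constant [Cs s], being positive, cancels between the integral and the mass of the tail. *)
Lemma mus_avgE d g : 0 < d -> wintegrable `]d, +oo[ g ->
  mus_avg s d g = 2 * s * d `^ (2 * s) * wint `]d, +oo[ g.
Proof.
move=> d0 i; have [i1 e1] := wint_tail1 d0.
rewrite /mus_avg /mus_tail !mus_intE//= e1 powRN.
have C0 := Cs_gt0 s_gt s_lt.
have p0 : 0 < d `^ (2 * s) by exact: powR_gt0.
by field; rewrite !gt_eqF.
Qed.

End Weight.

(** * Tail integrals as their lower limit tends to 0 *)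

Section SingularIntegral.
Context {R : realType}.
Variable s : R.
Hypothesis s_gt : 2^-1 < s.
Hypothesis s_lt : s < 1.
Implicit Types (a b c d e h r t w K M A : R) (g : R -> R).
Local Notation leb := (@lebesgue_measure R).

Let s21 : 0 < 2 * s - 1. Proof. by have := s_gt; lra. Qed.
Let q0 : 0 < 2 - 2 * s. Proof. by have := s_lt; lra. Qed.
Let mitv (i : interval R) : measurable [set` i] := measurable_itv i.

(** The comparison is asked only for t < b because the balls are open and the expansions of phi stop
    short of their radius; the end point b is a null set. *)
Lemma wint_le_itv a b g1 g2 : wintegrable s `]a, b] g1 -> wintegrable s `]a, b] g2 ->
  (forall t, a < t -> t < b -> g1 t <= g2 t) ->
  wint s `]a, b] g1 <= wint s `]a, b] g2.
Proof.
move=> i1 i2 h.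
have sub : (`]a, b[ : set R) `<=` `]a, b].
  by move=> t /=; rewrite !in_itv/= => /andP[-> /ltW].
have i1' := wintegrableS (mitv _) (mitv _) sub i1.
have i2' := wintegrableS (mitv _) (mitv _) sub i2.
rewrite /wint -!Rintegral_itv_bndo_bndc//.
by apply: wint_le => // t /=; rewrite in_itv/= => /andP[]; exact: h.
Qed.

(** Squeeze g between (h - w) t^2 and (h + w) t^2, whose integrals are explicit. *)
Lemma wint_itv_quadratic a b g h w : 0 < a -> a < b -> wintegrable s `]a, b] g ->
  (forall t, a < t -> t < b -> `|g t - h * t ^+ 2| <= w * t ^+ 2) ->
  `|wint s `]a, b] g - h * ((b `^ (2 - 2 * s) - a `^ (2 - 2 * s)) / (2 - 2 * s))|
   <= w * ((b `^ (2 - 2 * s) - a `^ (2 - 2 * s)) / (2 - 2 * s)).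
Proof.
move=> a0 ab ig H.
have [iu eu] := wint_itv_poly s_gt s_lt 0 (h + w) a0 ab.
have [il el] := wint_itv_poly s_gt s_lt 0 (h - w) a0 ab.
set X := (b `^ _ - _) / _ in eu el *.
rewrite ler_norml lerBrDl [X in _ && X]lerBlDl.
have -> : h * X - w * X = wint s `]a, b] (fun t => 0 * t + (h - w) * t ^+ 2).
  by rewrite el; ring.
have -> : h * X + w * X = wint s `]a, b] (fun t => 0 * t + (h + w) * t ^+ 2).
  by rewrite eu; ring.
apply/andP; split; apply: wint_le_itv => // t ta tb.
- by have := H t ta tb; rewrite ler_norml => /andP[+ _]; lra.
- by have := H t ta tb; rewrite ler_norml => /andP[_]; lra.
Qed.

Lemma wint_tail_diff d b g : 0 < d -> d < b -> wintegrable s `]d, +oo[ g ->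
  wintegrable s `]d, b] g /\ wint s `]d, +oo[ g - wint s `]b, +oo[ g = wint s `]d, b] g.
Proof.
move=> d0 db ig; split.
  apply: wintegrableS ig => // t /=; rewrite !in_itv/= andbT.
  by case/andP.
by rewrite (wint_split (ltW db) ig) addrK.
Qed.

Lemma cvg_powR_at0 (c : R) :
  (c * (d `^ (2 - 2 * s) / (2 - 2 * s))) @[d --> 0^'+] --> (0 : R).
Proof.
rewrite -[X in _ --> X](mulr0 c); apply: cvgM; first exact: cvg_cst.
rewrite -[X in _ --> X](mul0r (2 - 2 * s)^-1).
by apply: cvgM; [exact: powR_cvg0|exact: cvg_cst].
Qed.

(** For bounded integrands that are O(t^2) at 0, such as the one of the pair (v, v). The estimate
    says that the part of the integral over (0, e) differs from that of h t^2 by at most that of w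
    t^2; [Cs s] is kept out of L. *)
Lemma mus_int0_quadratic g M K r : measurable_fun [set: R] g ->
  (forall t, `|g t| <= M) -> 0 < r ->
  (forall t, 0 < t -> t < r -> `|g t| <= K * t ^+ 2) ->
  exists L : R, mus_int0 s g = (Cs s * L)%:E /\
   forall e h w, 0 < e ->
    (forall t, 0 < t -> t < e -> `|g t - h * t ^+ 2| <= w * t ^+ 2) ->
    `|L - wint s `]e, +oo[ g - h * (e `^ (2 - 2 * s) / (2 - 2 * s))|
     <= w * (e `^ (2 - 2 * s) / (2 - 2 * s)).
Proof.
move=> mg gM r0 gK.
have ig d : 0 < d -> wintegrable s `]d, +oo[ g.
  by move=> d0; exact: wintegrable_bounded gM.
pose J d := wint s `]d, +oo[ g.
(* The subtracted term is the integral of K t^2 over (0, d). *)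
pose H d := J d - K * (d `^ (2 - 2 * s) / (2 - 2 * s)).
have K0 : 0 <= K.
  have := gK (r / 2) ltac:(lra) ltac:(lra).
  move=> /(le_trans (normr_ge0 _)); rewrite pmulr_lge0// exprn_gt0//; lra.
have JE a b : 0 < a -> a < b -> b <= r ->
    `|J a - J b| <= K * ((b `^ (2 - 2 * s) - a `^ (2 - 2 * s)) / (2 - 2 * s)).
  move=> a0 ab br; have [i1] := wint_tail_diff a0 ab (ig _ a0).
  rewrite /J => ->.
  have := @wint_itv_quadratic a b g 0 K a0 ab i1; rewrite !mul0r subr0; apply.
  move=> t ta tb; rewrite mul0r subr0; apply: gK; first exact: lt_trans ta.
  exact: lt_le_trans br.
(* [H] is monotone, because [g + K t^2] is nonnegative near 0. *)
have cH : cvg (H d @[d --> 0^'+]).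
  apply: nonincreasing_at_right_is_cvgr.
  - near=> x => a b; rewrite !in_itv/= => /andP[a0 ax] /andP[b0 bx].
    rewrite le_eqVlt => /predU1P[->//|ab].
    have xr : x <= r by near: x; exact: nbhs_right_le.
    have := JE _ _ a0 ab (ltW (lt_le_trans bx xr)).
    by rewrite ler_norml => /andP[+ _]; rewrite /H mulrBl mulrBr; lra.
  - near=> x; exists (J r + K * (r `^ (2 - 2 * s) / (2 - 2 * s))) => _ [d + <-].
    rewrite /= in_itv/= => /andP[d0 dx].
    have xr : x <= r by near: x; exact: nbhs_right_le.
    have dr : d < r by exact: lt_le_trans xr.
    have := JE _ _ d0 dr (lexx _); rewrite ler_norml => /andP[_].
    have : 0 <= K * (d `^ (2 - 2 * s) / (2 - 2 * s)).
      by rewrite mulr_ge0// divr_ge0 ?powR_ge0// ltW.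
    by rewrite /H mulrBl mulrBr; lra.
pose L := lim (H d @[d --> 0^'+]).
have cJ : J d @[d --> 0^'+] --> L.
  have -> : J = (fun d => H d + K * (d `^ (2 - 2 * s) / (2 - 2 * s))).
    by apply/funext => d; rewrite /H subrK.
  by rewrite -[X in _ --> X](addr0 L); apply: cvgD => //; exact: cvg_powR_at0.
exists L; split.
  rewrite /mus_int0; apply: cvg_lim => //.
  have cEJ : (Cs s * J d)%:E @[d --> 0^'+] --> (Cs s * L)%:E.
    by apply: cvg_EFin; [exact: nearW|apply: cvgM => //; exact: cvg_cst].
  apply: cvg_trans cEJ; apply: near_eq_cvg.
  near=> d; have d0 : 0 < d by near: d; exact: nbhs_right_gt.
  by rewrite mus_intE//; exact: ig.
move=> e h w e0 hw.
(* Let d tend to 0 in the estimate on ]d, e]. The two terms in d stand for the missing integrals of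
   h t^2 and w t^2 over (0, d), and vanish in the limit. *)
have C : (`|J d - J e - h * (e `^ (2 - 2 * s) / (2 - 2 * s))
     + h * (d `^ (2 - 2 * s) / (2 - 2 * s))|
     + w * (d `^ (2 - 2 * s) / (2 - 2 * s))) @[d --> 0^'+] -->
   `|L - J e - h * (e `^ (2 - 2 * s) / (2 - 2 * s)) + 0| + 0.
  apply: cvgD; last exact: cvg_powR_at0.
  apply: cvg_norm; apply: cvgD; last exact: cvg_powR_at0.
  apply: cvgB; last exact: cvg_cst.
  by apply: cvgB => //; exact: cvg_cst.
rewrite !addr0 in C.
apply: (cvgr_to_le C).
near=> d; have d0 : 0 < d by near: d; exact: nbhs_right_gt.
have de : d < e by near: d; exact: nbhs_right_lt.
have [i1 E] := wint_tail_diff d0 de (ig _ d0).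
have hw' t : d < t -> t < e -> `|g t - h * t ^+ 2| <= w * t ^+ 2.
  by move=> dt te; apply: hw => //; exact: lt_trans dt.
have := wint_itv_quadratic d0 de i1 hw'.
by rewrite -E -/(J d) -/(J e) !mulrBl !mulrBr opprB addrA addrAC -lerBrDr.
Unshelve. all: by end_near. Qed.

Lemma powR_at0_pinfty r (c T A : R) : 0 < c ->
  \forall d \near 0^'+, - c * (d `^ (1 - 2 * s) - r) + T <= A.
Proof.
move=> c0.
have h : d `^ (1 - 2 * s) @[d --> 0^'+] --> +oo.
  have -> : (fun d => d `^ (1 - 2 * s)) = (fun d => (d `^ (2 * s - 1))^-1) :> (R -> R).
    by apply/funext => d /=; rewrite -powRN opprB.
  apply/(@cvgrVy _ _ _ _ (fun d => d `^ (2 * s - 1))); last exact: powR_cvg0.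
  near=> d; apply: powR_gt0; near: d; exact: nbhs_right_gt.
move/cvgryPge : h => /(_ (r + (T - A) / c)); apply: filterS => d.
by rewrite -lerBrDl ler_pdivrMr// mulrC mulrBr; lra.
Unshelve. all: by end_near. Qed.

(** Integrating -c t against the weight produces a negative multiple of d^(1-2s), which tends to -oo
    because s > 1/2; the t^2 part and the part beyond r stay bounded above. *)
Lemma wint_tail_Ny g M c K r A : measurable_fun [set: R] g ->
  (forall t, `|g t| <= M) -> 0 < r -> 0 < c ->
  (forall t, 0 < t -> t < r -> g t <= - c * t + K * t ^+ 2) ->
  \forall d \near 0^'+, wint s `]d, +oo[ g <= A.
Proof.
move=> mg gM r0 c0 gK.
have ig d : 0 < d -> wintegrable s `]d, +oo[ g.
  by move=> d0; exact: wintegrable_bounded gM.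
have c0' : 0 < c / (2 * s - 1) by rewrite divr_gt0.
have B := powR_at0_pinfty (r `^ (1 - 2 * s))
  (`|K| * (r `^ (2 - 2 * s) / (2 - 2 * s)) + wint s `]r, +oo[ g) A c0'.
near=> d.
have d0 : 0 < d by near: d; exact: nbhs_right_gt.
have dr : d < r by near: d; exact: nbhs_right_lt.
have [i1 E] := wint_tail_diff d0 dr (ig _ d0).
have [i2 E2] := wint_itv_poly s_gt s_lt (- c) K d0 dr.
have le12 : wint s `]d, r] g <= wint s `]d, r] (fun t => - c * t + K * t ^+ 2).
  by apply: wint_le_itv => // t dt tr; apply: gK => //; exact: lt_trans dt.
have dA : - (c / (2 * s - 1)) * (d `^ (1 - 2 * s) - r `^ (1 - 2 * s)) +
  (`|K| * (r `^ (2 - 2 * s) / (2 - 2 * s)) + wint s `]r, +oo[ g) <= A.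
  by near: d.
rewrite -(subrK (wint s `]r, +oo[ g) (wint s `]d, +oo[ g)) E.
apply: le_trans dA; rewrite addrA lerD2r (le_trans le12)// E2.
apply: lerD; first by rewrite [leLHS]mulrA !mulNr lerN2 mulrAC.
apply: (@le_trans _ _ (`|K| * ((r `^ (2 - 2 * s) - d `^ (2 - 2 * s)) / (2 - 2 * s)))).
  rewrite ler_wpM2r ?ler_norm// divr_ge0 ?(ltW q0)// subr_ge0.
  by rewrite ge0_ler_powR ?nnegrE ?(ltW q0) ?(ltW d0) ?(ltW r0) ?(ltW dr).
rewrite ler_wpM2l// ler_pM2r ?invr_gt0// gerBl powR_ge0//.
Unshelve. all: by end_near. Qed.

Lemma mus_int0_Ny g M c K r : measurable_fun [set: R] g ->
  (forall t, `|g t| <= M) -> 0 < r -> 0 < c ->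
  (forall t, 0 < t -> t < r -> g t <= - c * t + K * t ^+ 2) ->
  mus_int0 s g = -oo%E.
Proof.
move=> mg gM r0 c0 gK; rewrite /mus_int0; apply: cvg_lim => //.
apply/cvgeNyPle => A.
have := wint_tail_Ny (A / Cs s) mg gM r0 c0 gK.
have C0 := Cs_gt0 s_gt s_lt.
move=> B; near=> d; have d0 : 0 < d by near: d; exact: nbhs_right_gt.
rewrite mus_intE; last exact: wintegrable_bounded gM.
by rewrite lee_fin mulrC -ler_pdivlMr//; near: d.
Unshelve. all: by end_near. Qed.

Lemma mus_int0_y g M c K r : measurable_fun [set: R] g ->
  (forall t, `|g t| <= M) -> 0 < r -> 0 < c ->
  (forall t, 0 < t -> t < r -> c * t - K * t ^+ 2 <= g t) ->
  mus_int0 s g = +oo%E.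
Proof.
move=> mg gM r0 c0 gK; rewrite /mus_int0; apply: cvg_lim => //.
apply/cvgeyPge => A.
(* Reduction to [wint_tail_Ny] for -g, written as a multiple so that [wintZ] pulls the sign out. *)
have mg' : measurable_fun [set: R] (fun t => -1 * g t) by exact: measurable_funM.
have gM' t : `|-1 * g t| <= M by rewrite mulN1r normrN.
have gK' t : 0 < t -> t < r -> -1 * g t <= - c * t + K * t ^+ 2.
  by move=> t0 tr; have := gK t t0 tr; lra.
have := wint_tail_Ny (- (A / Cs s)) mg' gM' r0 c0 gK'.
have C0 := Cs_gt0 s_gt s_lt.
move=> B; near=> d; have d0 : 0 < d by near: d; exact: nbhs_right_gt.
have ig : wintegrable s `]d, +oo[ g by exact: wintegrable_bounded gM.
rewrite mus_intE// lee_fin mulrC -ler_pdivrMr// -lerN2 -mulN1r -wintZ//.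
by near: d.
Unshelve. all: by end_near. Qed.

End SingularIntegral.

(** * First and second order expansions *)

Section Calculus.
Context {R : realType} {N : nat}.
Implicit Types (f phi : 'rV[R]_N -> R) (x z u v w : 'rV[R]_N) (r t : R).

Lemma derive_dot_grad f z u : differentiable f z -> 'D_u f z = dot (grad f z) u.
Proof.
move=> df; rewrite deriveE// [in LHS](row_sum_delta u) linear_sum /dot.
apply: eq_bigr => i _; rewrite linearZ/= mulrC; congr (_ * _).
by rewrite mxE deriveE.
Qed.

Lemma is_derive_line f z u r : differentiable f (z + r *: u) ->
  is_derive r 1 (fun r : R => f (z + r *: u)) (dot (grad f (z + r *: u)) u).
Proof.
move=> df; rewrite -derive_dot_grad//.
have E : (fun h : R => h^-1 *: (f (z + (h *: (1 : R) + r) *: u) - f (z + r *: u))) =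
  (fun h : R => h^-1 *: (f (h *: u + (z + r *: u)) - f (z + r *: u))).
  apply/funext => h; congr (_ *: (f _ - _)).
  by rewrite [h *: 1]mulr1 scalerDl addrCA.
have du : derivable f (z + r *: u) u by exact: diff_derivable.
split; first by rewrite /derivable /= E.
by rewrite /derive /= E.
Qed.

(** The row index of [hess] is that of the first derivative: w, which tests the gradient, multiplies
    from the left, and the direction u pairs with the columns. *)
Lemma is_derive_grad_line phi z u w r :
  (forall i, differentiable ('D_(ebasis R i) phi) (z + r *: u)) ->
  is_derive r 1 (fun r : R => dot (grad phi (z + r *: u)) w)
    (dot (w *m hess phi (z + r *: u)) u).
Proof.
move=> df.
have -> : (fun r : R => dot (grad phi (z + r *: u)) w) =
    \sum_(i < N) (w ord0 i \*: (fun r : R => 'D_(ebasis R i) phi (z + r *: u))).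
  apply/funext => t; rewrite fct_sumE; apply: eq_bigr => i _.
  by rewrite mxE mulrC.
have -> : dot (w *m hess phi (z + r *: u)) u =
    \sum_(i < N) w ord0 i *: dot (grad ('D_(ebasis R i) phi) (z + r *: u)) u.
  rewrite /dot; under eq_bigr do rewrite mxE mulr_suml.
  rewrite exchange_big/=; apply: eq_bigr => i _.
  rewrite [RHS]mulr_sumr; apply: eq_bigr => j _.
  by rewrite !mxE mulrA.
apply: is_derive_sum => i.
by apply: is_deriveZ; exact: is_derive_line.
Qed.

Lemma is_derive_quadratic (a b r : R) :
  is_derive r 1 (fun r : R => a * r + b * r ^+ 2) (a + 2 * b * r).
Proof.
have -> : (fun r : R => a * r + b * r ^+ 2) = (a \*: (@id R)) + (b \*: (@id R) ^+ 2).
  by apply/funext => t.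
apply: is_derive_eq.
by rewrite /GRing.scale/= /GRing.scale/= expr1; ring.
Qed.

Lemma MVT01 (g g' : R -> R) t : 0 < t <= 1 ->
  (forall r, 0 <= r <= 1 -> is_derive r 1 g (g' r)) ->
  exists2 c, 0 <= c <= t & g t - g 0 = g' c * t.
Proof.
move=> /andP[t0 t1] dg.
have dg' r : r \in `]0, t[ -> is_derive r 1 g (g' r).
  rewrite in_itv/= => /andP[r0 rt]; apply: dg.
  by rewrite (ltW r0) (le_trans (ltW rt)).
have cg : {within `[0, t], continuous g}.
  apply: derivable_within_continuous => r; rewrite in_itv/= => /andP[r0 rt].
  by have [|] := dg r; rewrite ?r0 ?(le_trans rt).
have [c ct E] := MVT_segment (ltW t0) dg' cg.
by exists c; [move: ct; rewrite in_itv|rewrite E subr0].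
Qed.

(** Subtract from g the quadratics with slope g'(0) and second derivative h + w or h - w: the
    derivative of the difference then has a constant sign, and the mean value theorem on [0, 1]
    gives one inequality for each. *)
Lemma taylor2_01 (g g' : R -> R) (h w : R) :
  (forall r, 0 <= r <= 1 -> is_derive r 1 g (g' r)) ->
  (forall r, 0 <= r <= 1 -> `|g' r - g' 0 - h * r| <= w * r) ->
  `|g 1 - g 0 - g' 0 - h / 2| <= w / 2.
Proof.
move=> dg H.
have M b : exists2 c, 0 <= c <= 1 &
    g 1 - g 0 - (g' 0 + b) = g' c - (g' 0 + 2 * b * c).
  have dk r : 0 <= r <= 1 -> is_derive r 1 (g - (fun r => g' 0 * r + b * r ^+ 2))
      (g' r - (g' 0 + 2 * b * r)).
    by move=> r01; apply: is_deriveB; [exact: dg|exact: is_derive_quadratic].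
  have [|c c01 E] := MVT01 _ dk (t := 1); first by rewrite ltr01 lexx.
  exists c => //; move: E; rewrite mulr1 => <-.
  rewrite -![(g - _) _]/(g _ - _) /=; ring.
have [c1 c1I E1] := M ((h + w) / 2); have [c2 c2I E2] := M ((h - w) / 2).
have := H _ c1I; have := H _ c2I; rewrite !ler_norml => /andP[A1 A2] /andP[B1 B2].
apply/andP; split; lra.
Qed.

End Calculus.

Section BallEstimates.
Context {R : realType} {N : nat}.
Variables (phi : 'rV[R]_N -> R) (x : 'rV[R]_N) (eta : R).
Hypothesis dphi : forall z, eball x eta z -> differentiable phi z.
Hypothesis dphi2 : forall i z, eball x eta z -> differentiable ('D_(ebasis R i) phi) z.
Implicit Types (z u v w a b : 'rV[R]_N) (r t B rho : R).

Lemma eball_addZ u r : enorm u < eta -> 0 <= r <= 1 -> eball x eta (x + r *: u).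
Proof.
move=> ue /andP[r0 r1]; rewrite /eball/= addrC addKr enormZ ger0_norm//.
by apply: le_lt_trans ue; rewrite ler_piMl ?enorm_ge0.
Qed.

(** Testing against a fixed w turns the gradient along the segment into a scalar function, to which
    the mean value theorem applies. *)
Lemma grad_lipschitz B z w :
  (forall z, eball x eta z -> opnorm (hess phi z) <= B) -> eball x eta z ->
  `|dot (grad phi z) w - dot (grad phi x) w| <= B * enorm (z - x) * enorm w.
Proof.
move=> HB xz; pose u := z - x.
have ball r : 0 <= r <= 1 -> eball x eta (x + r *: u) by exact: eball_addZ.
have [|c /andP[c0 c1]] := MVT01 (t := 1) _
  (fun r rI => is_derive_grad_line w (fun i => dphi2 i (ball r rI))).
  by rewrite ltr01 lexx.
have xu : x + u = z by rewrite addrC subrK.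
rewrite mulr1 scale1r scale0r addr0 xu => ->.
apply: le_trans (ler_dot_mulmx _ _ _) _.
rewrite -/u -!mulrA (mulrC (enorm u)).
rewrite ler_wpM2r ?mulr_ge0 ?enorm_ge0//; apply: HB; apply: ball.
by rewrite c0.
Qed.

(** The error carries the factor |a - b|, which expanding phi at x + a and at x + b separately would
    lose. The mean value theorem is applied between the two points, and the gradient on their
    segment is compared with that at x. *)
Lemma first_order_two_points B rho a b :
  (forall z, eball x eta z -> opnorm (hess phi z) <= B) ->
  rho < eta -> enorm a <= rho -> enorm b <= rho ->
  `|phi (x + a) - phi (x + b) - dot (grad phi x) (a - b)| <= B * rho * enorm (a - b).
Proof.
move=> HB re ar br.
have B0 : 0 <= B.
  apply: le_trans (opnorm_ge0 _) (HB x _).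
  by rewrite /eball/= subrr enorm0 (le_lt_trans _ re)// (le_trans _ ar)// enorm_ge0.
have nball r : 0 <= r <= 1 -> enorm (b + r *: (a - b)) <= rho.
  move=> /andP[r0 r1].
  have -> : b + r *: (a - b) = (1 - r) *: b + r *: a.
    by rewrite scalerBr scalerBl scale1r addrA addrAC.
  apply: le_trans (ler_enormD _ _) _; rewrite !enormZ !ger0_norm ?subr_ge0//.
  have -> : rho = (1 - r) * rho + r * rho by ring.
  by apply: lerD; rewrite ler_wpM2l ?subr_ge0.
have ball r : 0 <= r <= 1 -> eball x eta ((x + b) + r *: (a - b)).
  by move=> rI; rewrite /eball/= -(addrA x) (addrC x) addrK (le_lt_trans (nball _ rI)).
have [|c cI] := MVT01 (t := 1) _ (fun r rI => is_derive_line (dphi (ball r rI))).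
  by rewrite ltr01 lexx.
have xa : x + b + (a - b) = x + a by rewrite -addrA [b + _]addrC subrK.
rewrite mulr1 scale1r scale0r addr0 xa => ->.
apply: le_trans (grad_lipschitz _ HB (ball c cI)) _.
rewrite ler_wpM2r ?enorm_ge0// ler_wpM2l// -(addrA x) (addrC x) addrK.
exact: nball.
Qed.

(** The mean value theorem for the gradient, with the Hessian at x subtracted, supplies the
    hypothesis of [taylor2_01] on the segment from x to x + u. *)
Lemma second_order_point (e w0 : R) u : e <= eta -> enorm u < e ->
  (forall z, eball x e z -> opnorm (hess phi z - hess phi x) <= w0) ->
  `|phi (x + u) - phi x - dot (grad phi x) u - dot (u *m hess phi x) u / 2|
   <= w0 * enorm u ^+ 2 / 2.
Proof.
move=> ee ue Hw.
have ball r : 0 <= r <= 1 -> eball x eta (x + r *: u).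
  by apply: eball_addZ; exact: lt_le_trans ee.
have balle r : 0 <= r <= 1 -> eball x e (x + r *: u).
  move=> /andP[r0 r1]; rewrite /eball/= addrC addKr enormZ ger0_norm//.
  by apply: le_lt_trans ue; rewrite ler_piMl ?enorm_ge0.
have := @taylor2_01 R (fun r => phi (x + r *: u))
  (fun r => dot (grad phi (x + r *: u)) u) (dot (u *m hess phi x) u) (w0 * enorm u ^+ 2)
  (fun r rI => is_derive_line (dphi (ball r rI))).
rewrite scale1r scale0r addr0; apply=> r /andP[]; rewrite le_eqVlt => /predU1P[<- _|r0 r1].
  by rewrite scale0r addr0 !mulr0 !subr0 subrr normr0.
have [|c /andP[c0 cr]] := MVT01 (t := r) _
  (fun r rI => is_derive_grad_line u (fun i => dphi2 i (ball r rI))).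
  by rewrite r0.
rewrite scale0r addr0 => ->.
rewrite -mulrBl -dotNl -dotDl -mulmxBr normrM (gtr0_norm r0) ler_wpM2r ?(ltW r0)//.
apply: le_trans (ler_dot_mulmx _ _ _) _.
rewrite -mulrA -expr2 ler_wpM2r ?sqr_ge0//; apply: Hw; apply: balle.
by rewrite c0 (le_trans cr).
Qed.

End BallEstimates.

(** * Supremum plus infimum over a small ball *)

Section SupOnBall.
Context {R : realType} {N : nat}.
Implicit Types (f : 'rV[R]_N -> R) (p u v : 'rV[R]_N) (H : 'M[R]_N).

(* Completing the square: for [|u| < e] and [d = |u - e v|], [p.u = |p|(|u|^2 + e^2 - d^2)/(2e)]
   and [Hu.u - e^2 Hv.v <= 2 e K d]. *)
Lemma quadratic_le_on_ball p v H (K e : R) u : 0 < e -> enorm v = 1 -> p != 0 ->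
  p = enorm p *: v ->
  (forall a b, `|dot (a *m H) b| <= K * enorm a * enorm b) -> enorm u < e ->
  dot p u + dot (u *m H) u / 2 <=
  e * enorm p + e ^+ 2 * dot (v *m H) v / 2 + e ^+ 3 * K ^+ 2 / (2 * enorm p).
Proof.
move=> e0 v1 p0 pE HK ue.
have P0 := enorm_gt0 p0; set P := enorm p in pE P0 *.
have u0 := enorm_ge0 u.
set d := enorm (u - e *: v); have d0 : 0 <= d := enorm_ge0 _.
have K0 : 0 <= K by have := HK v v; rewrite v1 !mulr1; apply: le_trans.
have vv : dot v v = 1 by rewrite -sqr_enorm v1 expr1n.
have dE : d ^+ 2 = enorm u ^+ 2 - 2 * e * dot v u + e ^+ 2.
  by rewrite /d !sqr_enorm !dotE vv (dotC u v); ring.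
have pu : dot p u <= P * e - P * d ^+ 2 / (2 * e).
  rewrite pE dotZl -mulrA -mulrBr ler_wpM2l ?(ltW P0)//.
  rewrite lerBrDl -(ler_pM2r (_ : 0 < 2 * e)); last by rewrite mulr_gt0.
  rewrite mulrDl divfK ?gt_eqF ?mulr_gt0// dE.
  have : enorm u ^+ 2 <= e ^+ 2 by rewrite ler_pXn2r ?nnegrE ?(ltW ue)// ltW.
  lra.
have qu : dot (u *m H) u - e ^+ 2 * dot (v *m H) v <= 2 * e * K * d.
  (* Replace u by e v in one argument of the bilinear form at a time; each change brings out a
     factor u - e v. *)
  have -> : dot (u *m H) u - e ^+ 2 * dot (v *m H) v =
     dot ((u - e *: v) *m H) u + dot ((e *: v) *m H) (u - e *: v).
    by rewrite mulmxBl -scalemxAl !dotE; ring.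
  have h1 := le_trans (ler_norm _) (HK (u - e *: v) u).
  have h2 := le_trans (ler_norm _) (HK (e *: v) (u - e *: v)).
  rewrite enormZ v1 mulr1 (gtr0_norm e0) -/d in h2; rewrite -/d in h1.
  apply: le_trans (lerD h1 h2) _.
  have : K * d * enorm u <= K * d * e by rewrite ler_wpM2l ?mulr_ge0// ltW.
  lra.
(* The right-hand side is the maximum over d of the left one, reached at d = e^2 K / P. *)
have sq : e * K * d - P * d ^+ 2 / (2 * e) <= e ^+ 3 * K ^+ 2 / (2 * P).
  rewrite -subr_ge0.
  have -> : e ^+ 3 * K ^+ 2 / (2 * P) - (e * K * d - P * d ^+ 2 / (2 * e)) =
    (e ^+ 2 * K - P * d) ^+ 2 / (2 * P * e).
    by field; rewrite !gt_eqF.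
  by rewrite divr_ge0 ?sqr_ge0// !mulr_ge0// ltW.
lra.
Qed.

Lemma sup_on_ball f p v H (f0 K e w M : R) : 0 < e -> enorm v = 1 -> p != 0 ->
  p = enorm p *: v -> (forall u, f u <= M) ->
  (forall a b, `|dot (a *m H) b| <= K * enorm a * enorm b) ->
  0 <= w ->
  (forall u, enorm u < e ->
    `|f u - f0 - dot p u - dot (u *m H) u / 2| <= w * enorm u ^+ 2 / 2) ->
  let S := sup [set f u | u in [set u | enorm u < e]] in
  f0 + e * enorm p + e ^+ 2 * dot (v *m H) v / 2 - w * e ^+ 2 / 2 <= S /\
  S <= f0 + e * enorm p + e ^+ 2 * dot (v *m H) v / 2 + w * e ^+ 2 / 2
       + e ^+ 3 * K ^+ 2 / (2 * enorm p).
Proof.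
move=> e0 v1 p0 pE fM HK w0 Hf S.
have ne : [set f u | u in [set u | enorm u < e]] !=set0.
  by exists (f 0), 0 => //=; rewrite enorm0.
have vv : dot v v = 1 by rewrite -sqr_enorm v1 expr1n.
split; last first.
  apply: ge_sup => // _ [u /= ue <-].
  have := Hf u ue; rewrite ler_norml => /andP[_ h].
  have := quadratic_le_on_ball e0 v1 p0 pE HK ue.
  have : w * enorm u ^+ 2 <= w * e ^+ 2.
    by rewrite ler_wpM2l// ler_pXn2r ?nnegrE ?enorm_ge0 ?(ltW ue) ?(ltW e0).
  lra.
(* The point e v lies on the boundary of the open ball, so the lower bound is obtained at r v and r
   is sent to e from below. *)
have C : (f0 + r * enorm p + r ^+ 2 * dot (v *m H) v / 2 - w * r ^+ 2 / 2) @[r --> e^'-] -->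
   f0 + e * enorm p + e ^+ 2 * dot (v *m H) v / 2 - w * e ^+ 2 / 2.
  apply: cvg_at_left_filter.
  apply: cvgB.
    apply: cvgD; first by apply: cvgD; [exact: cvg_cst|apply: cvgM; [exact: cvg_id|exact: cvg_cst]].
    apply: cvgM; last exact: cvg_cst.
    by apply: cvgM; [exact: exprn_continuous|exact: cvg_cst].
  apply: cvgM; last exact: cvg_cst.
  by apply: cvgM; [exact: cvg_cst|exact: exprn_continuous].
apply: (cvgr_to_le C).
near=> r.
have r0 : 0 < r by near: r; exact: nbhs_left_gt.
have re : r < e by near: r; exact: nbhs_left_lt.
have nr : enorm (r *: v) = r by rewrite enormZ v1 mulr1 gtr0_norm.
have : f (r *: v) <= S.
  apply: ub_le_sup; first by exists M => _ [u _ <-].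
  by exists (r *: v) => //=; rewrite nr.
have := Hf (r *: v); rewrite nr => /(_ re); rewrite ler_norml => /andP[+ _].
have -> : dot p (r *: v) = r * enorm p by rewrite [in LHS]pE dotZl dotZr vv mulr1 mulrC.
rewrite -scalemxAl !dotE; lra.
Unshelve. all: by end_near. Qed.

(** The infimum is minus the supremum of -f, whose data are -p, -v and -H, so the first order terms
    e |p| cancel in the sum. The excess e^3 K^2 / (2|p|) occurs only in the upper bound of each
    supremum, hence just once on either side. *)
Lemma sup_inf_on_ball f p v H (f0 K e w M : R) : 0 < e -> enorm v = 1 -> p != 0 ->
  p = enorm p *: v -> (forall u, `|f u| <= M) ->
  (forall a b, `|dot (a *m H) b| <= K * enorm a * enorm b) ->
  0 <= w ->
  (forall u, enorm u < e ->
    `|f u - f0 - dot p u - dot (u *m H) u / 2| <= w * enorm u ^+ 2 / 2) ->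
  `|sup [set f u | u in [set u | enorm u < e]] +
    inf [set f u | u in [set u | enorm u < e]] - 2 * f0 - e ^+ 2 * dot (v *m H) v|
    <= w * e ^+ 2 + e ^+ 3 * K ^+ 2 / (2 * enorm p).
Proof.
move=> e0 v1 p0 pE fM HK w0 Hf.
set E := [set f u | u in _].
have fMu u : f u <= M by have := fM u; rewrite ler_norml => /andP[].
have /= [S1 S2] := sup_on_ball e0 v1 p0 pE fMu HK w0 Hf.
have infE : inf E = - sup [set (- f u) | u in [set u | enorm u < e]].
  by rewrite /inf /E image_comp.
have fM' u : - f u <= M.
  by have := fM u; rewrite ler_norml lerNl => /andP[].
have HK' a b : `|dot (a *m - H) b| <= K * enorm a * enorm b.
  by rewrite mulmxN dotNl normrN.
have Hf' u : enorm u < e ->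
    `|- f u - - f0 - dot (- p) u - dot (u *m - H) u / 2| <= w * enorm u ^+ 2 / 2.
  move=> /Hf; rewrite mulmxN !dotNl -normrN; congr (`|_| <= _); ring.
have v1' : enorm (- v) = 1 by rewrite enormN.
have p0' : - p != 0 by rewrite oppr_eq0.
have pE' : - p = enorm (- p) *: - v by rewrite enormN scalerN -pE.
have /= [S3 S4] := sup_on_ball e0 v1' p0' pE' fM' HK' w0 Hf'.
rewrite infE; move: S1 S2 S3 S4.
rewrite mulmxN mulNmx opprK dotNr enormN -/E.
set A := sup E; set B := sup _; set q := dot (v *m H) v => S1 S2 S3 S4.
by rewrite ler_norml; apply/andP; split; lra.
Qed.

End SupOnBall.

(** * Regularity and modulus of continuity *)

Section Topology.
Context {R : realType} {N : nat}.
Implicit Types (phi : 'rV[R]_N -> R) (x y z w : 'rV[R]_N).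

Lemma enorm_sub_lipschitz z w : `|enorm z - enorm w| <= N%:R * `|z - w|.
Proof.
apply: le_trans (enorm_le_mx_norm _).
rewrite ler_norml lerBlDr lerNl opprB lerBlDr; apply/andP; split.
  by rewrite enormB; apply: le_trans (ler_enormD _ _); rewrite subrK.
by apply: le_trans (ler_enormD _ _); rewrite subrK.
Qed.

Lemma continuous_enorm_sub x : continuous (fun z : 'rV[R]_N => enorm (z - x)).
Proof.
move=> z; apply/(@cvgrPdist_le _ _ _ (nbhs z) (nbhs_filter z)) => e e0.
(* N + 1 keeps the divisor positive for N = 0 too. *)
have N0 : 0 < N%:R + 1 :> R by rewrite ltr_pwDr.
near=> w.
apply: le_trans (enorm_sub_lipschitz _ _) _.
have -> : z - x - (w - x) = z - w by rewrite opprB addrA subrK.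
have zw : `|z - w| <= e / (N%:R + 1).
  near: w.
  have /cvgr_dist_le : id @ nbhs z --> z by exact: cvg_id.
  by apply; rewrite divr_gt0.
apply: (@le_trans _ _ ((N%:R + 1) * (e / (N%:R + 1)))).
  by apply: ler_pM => //; rewrite lerDl.
by rewrite mulrC divfK ?gt_eqF.
Unshelve. all: by end_near. Qed.

Lemma compact_ecball x (r : R) : compact (ecball x r).
Proof.
apply: bounded_closed_compact.
  exists (r + `|x|); split; first exact: num_real.
  move=> K rK z /= zx; rewrite -(subrK x z).
  apply: le_trans (ler_normD _ _) _; apply/ltW/(le_lt_trans _ rK).
  by rewrite lerD2r; apply: le_trans zx; exact: mx_norm_le_enorm.
have -> : ecball x r = (fun z => enorm (z - x)) @^-1` [set t | t <= r] by [].
by apply: closed_comp => [z _|]; [exact: continuous_enorm_sub|exact: closed_le].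
Qed.

(** The Hessian itself lives on the open ball, but its continuous extension to the compact closed
    ball is bounded. This makes the supremum in [Cx] an upper bound. *)
Lemma opnorm_hess_bounded phi x (eta : R) : hypH phi x eta ->
  exists K : R, forall z, eball x eta z -> opnorm (hess phi z) <= K.
Proof.
move=> [_ _ [_ _ _ _ [_ [h [ch hE]]]] _].
have [M [_ HM]] := compact_bounded (continuous_compact ch (@compact_ecball x eta)).
exists (N%:R ^+ 2 * (M + 1)) => z ze.
apply: le_trans (opnorm_le_mx_norm _) _.
rewrite ler_wpM2l//; apply: HM; first by rewrite ltrDl.
by exists z; [exact: ltW|exact: hE].
Qed.

(** Good sets: those whose preimage under the line is measurable form a sigma-algebra containing the
    open sets, hence all Borel sets in the sense of [hypH]. *)
Lemma measurable_fun_line phi x y :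
  (forall B : set R, measurable B ->
     smallest (sigma_algebra setT) [set U : set 'rV[R]_N | open U] (phi @^-1` B)) ->
  measurable_fun [set: R] (fun t : R => phi (x + t *: y)).
Proof.
move=> mphi _ B mB; rewrite setTI.
pose l (t : R) := x + t *: y.
have cl : continuous l.
  move=> t; apply: cvgD; first exact: cvg_cst.
  by apply: cvgZr_tmp; exact: cvg_id.
apply: (mphi _ mB [set A | measurable (l @^-1` A)]); split => /=.
- split => /=.
  + by rewrite preimage_set0.
  + by move=> A mA; rewrite setTD preimage_setC; exact: measurableC.
  + by move=> A mA; rewrite preimage_bigcup; exact: bigcupT_measurable.
- move=> U oU /=; apply: open_measurable.
  by apply: open_comp => // t _; exact: cl.
Qed.

End Topology.

Section Modulus.
Context {R : realType} {N : nat}.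
Variables (phi : 'rV[R]_N -> R) (x : 'rV[R]_N) (eta M : R).
Hypothesis N0 : (0 < N)%N.
Hypothesis eta0 : 0 < eta.
Hypothesis phiM : forall z, `|phi z| <= M.
Implicit Types (z w y v : 'rV[R]_N) (a b t : R).

Let omega_set a := [set r : R | exists z w : 'rV[R]_N,
  [/\ ~ ecball x eta z, ~ ecball x eta w, enorm (z - w) <= a & r = `|phi z - phi w|]].

Let omega_ubound a : has_ubound (omega_set a).
Proof.
exists (M + M) => _ [z [w [_ _ _ ->]]].
by apply: le_trans (ler_normB _ _) _; exact: lerD.
Qed.

Lemma omega_ge a z w : ~ ecball x eta z -> ~ ecball x eta w ->
  enorm (z - w) <= a -> `|phi z - phi w| <= omega phi x eta a.
Proof.
move=> xz xw zw; apply: ub_le_sup; first exact: omega_ubound.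
by exists z, w.
Qed.

(** Makes the set behind [omega] nonempty. For N = 0 the ball would be the whole space. *)
Lemma exists_outside : exists z, ~ ecball x eta z.
Proof.
pose i := Ordinal N0.
exists (x + (eta + 1) *: delta_mx ord0 i); rewrite /ecball/= addrC addKr => h.
have := le_trans (ler_enorm_coord ((eta + 1) *: delta_mx ord0 i) i) h.
rewrite !mxE !eqxx mulr1 gtr0_norm => [|]; last by have := eta0; lra.
by rewrite leNgt ltrDl ltr01.
Qed.

Lemma omega_ge0 a : 0 <= a -> 0 <= omega phi x eta a.
Proof.
move=> a0; have [z xz] := exists_outside.
have := @omega_ge a z z xz xz; rewrite !subrr normr0; apply.
by rewrite enorm0.
Qed.

Lemma le_omega a b : 0 <= a -> a <= b -> omega phi x eta a <= omega phi x eta b.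
Proof.
move=> a0 ab; apply: ge_sup.
  have [z xz] := exists_outside.
  by exists `|phi z - phi z|, z, z; split => //; rewrite subrr enorm0.
move=> _ [z [w [xz xw zw ->]]]; apply: omega_ge => //.
exact: le_trans ab.
Qed.

Lemma omega_chain a (f : nat -> 'rV[R]_N) n : (forall k, ~ ecball x eta (f k)) ->
  (forall k, enorm (f k - f k.+1) <= a) ->
  `|phi (f 0%N) - phi (f n)| <= n%:R * omega phi x eta a.
Proof.
move=> fo fa; elim: n => [|n IH]; first by rewrite subrr normr0 mul0r.
rewrite -(subrK (phi (f n)) (phi (f 0%N))) -addrA.
apply: le_trans (ler_normD _ _) _.
rewrite -natr1 mulrDl mul1r lerD//.
by apply: omega_ge.
Qed.

(** The sphere of radius t > eta about x avoids the closed ball, so every link of the great-circle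
    chain costs at most [omega] at the chord. *)
Lemma omega_sphere t y v : (1 < N)%N -> eta < t -> enorm y = 1 -> enorm v = 1 ->
  `|phi (x + t *: y) - phi (x + t *: v)| <=
    2 * (1 + t) * omega phi x eta (enorm (y - v)).
Proof.
move=> N1 et y1 v1.
have [n [f [nt f0 fn ft fs]]] := sphere_arc_chain N1 y1 v1 (lt_trans eta0 et).
have := @omega_chain (enorm (y - v)) (fun k => x + f k) n.
rewrite f0 fn => h; apply: le_trans (h _ _) _.
- move=> k; rewrite /ecball/= addrC addKr ft => te.
  by move: et; rewrite ltNge te.
- by move=> k; rewrite opprD addrACA subrr add0r.
- by rewrite ler_wpM2r// omega_ge0// enorm_ge0.
Qed.

End Modulus.

(** * The expansion *)

Section TailComparison.
Context {R : realType}.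
Variable s : R.
Hypothesis s_gt : 2^-1 < s.
Hypothesis s_lt : s < 1.
Implicit Types (a b c d e h r t w K M A C p : R) (g om : R -> R).

Lemma wint_tail_le g M e r (c1 c2 c3 : R) : measurable_fun [set: R] g ->
  (forall t, `|g t| <= M) -> 0 < e -> e < r ->
  (forall t, e < t -> t < r -> g t <= c1 * t + c2 * t ^+ 2) ->
  (forall t, r < t -> g t <= c3 * (1 + t)) ->
  wint s `]e, +oo[ g <=
    c1 * ((e `^ (1 - 2 * s) - r `^ (1 - 2 * s)) / (2 * s - 1)) +
    c2 * ((r `^ (2 - 2 * s) - e `^ (2 - 2 * s)) / (2 - 2 * s)) +
    c3 * (r `^ (- (2 * s)) / (2 * s) + r `^ (1 - 2 * s) / (2 * s - 1)).
Proof.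
move=> mg gM e0 er H1 H2.
have r0 : 0 < r by exact: lt_trans er.
have ig : wintegrable s `]e, +oo[ g by exact: wintegrable_bounded gM.
have igr : wintegrable s `]r, +oo[ g by exact: wintegrable_bounded gM.
have [i1 _] := wint_tail_diff e0 er ig.
have [i2 E2] := wint_itv_poly s_gt s_lt c1 c2 e0 er.
have [i3 E3] := wint_tail_affine s_gt c3 c3 r0.
rewrite (wint_split (ltW er) ig) -E2; apply: lerD; first exact: wint_le_itv.
rewrite mulrDr -E3; apply: wint_le => // t /=; rewrite in_itv/= andbT => /H2.
by rewrite mulrDr.
Qed.

(* A direction at distance [d > A] from the gradient direction cannot beat it:
   the linear loss [p d^2 P / 2] absorbs [2 C d Q <= p d^2 P / 16] and
   [2 om d W <= p d^2 P / 4]. *)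
Lemma direction_gain_le p C P Q W om d : 0 < p -> 0 <= C -> 0 < P -> 0 <= Q -> 0 <= W ->
  0 <= d <= 2 -> (forall a, 0 <= a -> 0 <= om a) ->
  (forall a b, 0 <= a -> a <= b -> om a <= om b) ->
  forall A, A = Num.max (32 * C * Q / (p * P))
    (sup [set a | 0 <= a <= 2 /\ a ^+ 2 <= 8 * om a / p * (W / P)]) ->
  [/\ 0 <= A, 0 <= 2 * C * Q * A + 2 * W * om A &
  - (p * d ^+ 2 / 2) * P + 2 * C * d * Q + 2 * om d * W <= 2 * C * Q * A + 2 * W * om A].
Proof.
move=> p0 C0 P0 Q0 W0 /andP[d0 d2] om0 omle A AE.
set k := sup _ in AE.
have T0 : 0 <= 32 * C * Q / (p * P) by rewrite divr_ge0 ?mulr_ge0// ltW.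
have TA : 32 * C * Q / (p * P) <= A by rewrite AE le_max lexx.
have kA : k <= A by rewrite AE le_max lexx orbT.
have A0 : 0 <= A by exact: le_trans TA.
have R0 : 0 <= 2 * C * Q * A + 2 * W * om A.
  by rewrite addr_ge0// !mulr_ge0// om0.
split => //.
(* For d <= A monotonicity is enough: the loss has the right sign and both gains at d are at most
   those at A. *)
have [dA|Ad] := leP d A.
  have h1 : 2 * C * d * Q <= 2 * C * Q * A.
    by rewrite -!mulrA ler_wpM2l// ler_wpM2l// mulrC ler_wpM2l.
  have h2 : 2 * om d * W <= 2 * W * om A.
    by rewrite -!mulrA ler_wpM2l// mulrC ler_wpM2l// omle.
  have h3 : 0 <= p * d ^+ 2 / 2 * P by rewrite !mulr_ge0 ?sqr_ge0// ltW.
  lra.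
have d_gt : 0 < d by exact: le_lt_trans Ad.
have h1 : 2 * C * d * Q <= p * d ^+ 2 / 16 * P.
  have : 32 * C * Q / (p * P) <= d by exact: le_trans (ltW Ad).
  rewrite ler_pdivrMr ?mulr_gt0// => h.
  have : d * (32 * C * Q) <= d * (d * (p * P)) by rewrite ler_wpM2l.
  by rewrite expr2; lra.
have h2 : 2 * om d * W <= p * d ^+ 2 / 4 * P.
  (* d lies in [0, 2] and above the supremum k, so it fails the inequality that defines the set of
     k. *)
  have : ~ (d ^+ 2 <= 8 * om d / p * (W / P)).
    move=> dk; suff : d <= k by rewrite leNgt (le_lt_trans kA Ad).
    apply: ub_le_sup; last by split; first rewrite d0 d2.
    by exists 2 => a /= [/andP[]].
  move=> /negP; rewrite -ltNge => h.
  have h' : 8 * om d / p * (W / P) * (p * P) <= d ^+ 2 * (p * P).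
    by rewrite ler_wpM2r ?mulr_ge0// ltW.
  have E : 8 * om d / p * (W / P) * (p * P) = 8 * (om d * W).
    by field; rewrite !gt_eqF.
  rewrite E in h'; lra.
have h3 : 0 <= p * d ^+ 2 * P by rewrite !mulr_ge0 ?sqr_ge0// ltW.
lra.
Qed.

End TailComparison.

Section SupInf.
Context {R : realType} {T : Type}.
Implicit Types (F : T -> R) (D : set T).

(** The supremum can only exceed F v and the infimum can only fall below F v', so the two errors
    have opposite signs and the bound is E instead of 2 E. *)
Lemma sup_inf_near F D (v v' : T) (E M : R) : D v -> D v' -> (forall y, `|F y| <= M) ->
  (forall y, D y -> F y - F v <= E) -> (forall y, D y -> F v' - F y <= E) ->
  `|sup (F @` D) + inf (F @` D) - (F v + F v')| <= E.
Proof.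
move=> Dv Dv' FM h1 h2.
have ne : F @` D !=set0 by exists (F v), v.
have ub : has_ubound (F @` D).
  by exists M => _ [y _ <-]; rewrite (le_trans (ler_norm _)).
have lb : has_lbound (F @` D).
  by exists (- M) => _ [y _ <-]; have := FM y; rewrite ler_norml => /andP[].
have s1 : F v <= sup (F @` D) by apply: ub_le_sup => //; exists v.
have s2 : sup (F @` D) <= F v + E.
  by apply: ge_sup => // _ [y Dy <-]; have := h1 y Dy; lra.
have i1 : inf (F @` D) <= F v' by apply: ge_inf => //; exists v'.
have i2 : F v' - E <= inf (F @` D).
  by apply: lb_le_inf => // _ [y Dy <-]; have := h2 y Dy; lra.
by rewrite ler_norml; apply/andP; split; lra.
Qed.

Lemma sup_inf_pair F D (v v' : T) : D v -> D v' ->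
  (forall y, D y -> y = v \/ y = v') ->
  sup (F @` D) + inf (F @` D) = F v + F v'.
Proof.
move=> Dv Dv' h.
have -> : F @` D = [set F v; F v'].
  apply/seteqP; split => [_ [y /h [->|->] <-]|_ [->|->]]; [left|right|exists v|exists v']; done.
wlog vv' : v v' Dv Dv' h / F v <= F v' => [H|].
  have [/H|/ltW /H] := leP (F v) (F v'); first exact.
  rewrite setUC addrC => ->//; first by rewrite addrC.
  by move=> y /h [->|->]; [right|left].
have -> : sup [set F v; F v'] = F v'.
  apply/eqP; rewrite eq_le; apply/andP; split.
    by apply: ge_sup => [|_ [->|->]]; first by exists (F v); left.
  by apply: ub_le_sup; [exists (F v') => _ [->|->]|right].
have -> : inf [set F v; F v'] = F v.
  apply/eqP; rewrite eq_le; apply/andP; split.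
    by apply: ge_inf; [exists (F v) => _ [->|->]|left].
  by apply: lb_le_inf => [|_ [->|->]]; first by exists (F v); left.
by rewrite addrC.
Qed.

End SupInf.

(** Polarization; this is the source of the quadratic loss in |y - v|. *)
Lemma dot_unit (R : realType) (N : nat) (y v : 'rV[R]_N) :
  enorm y = 1 -> enorm v = 1 -> dot v y = 1 - enorm (y - v) ^+ 2 / 2.
Proof.
move=> y1 v1; rewrite sqr_enorm !dotE -!sqr_enorm y1 v1 (dotC y v); lra.
Qed.

Lemma opnormB_le (R : realType) (N : nat) (A B : 'M[R]_N) :
  opnorm (A - B) <= opnorm A + opnorm B.
Proof.
apply: ge_sup; first by case: (opnorm_has_sup (A - B)).
move=> _ [v /= v1 <-]; rewrite mulmxBr.
apply: le_trans (ler_enormD _ _) _; rewrite enormN.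
by apply: lerD; apply: le_trans (enorm_mulmx_opnorm _ _) _;
  rewrite ler_piMr ?opnorm_ge0.
Qed.

(** * The nonlocal operator and the assembly of the error terms *)

Section Expansion.
Context {R : realType} {N : nat}.
Variables (s : R) (x : 'rV[R]_N) (eta : R) (phi : 'rV[R]_N -> R) (eps : R).
Hypothesis N0 : (0 < N)%N.
Hypothesis s_gt : 2^-1 < s.
Hypothesis s_lt : s < 1.
Hypothesis eta0 : 0 < eta.
Hypothesis H : hypH phi x eta.
Hypothesis p0 : grad phi x != 0.
Hypothesis eps0 : 0 < eps.
Hypothesis eps_eta : eps < eta.
Implicit Types (y yt z u : 'rV[R]_N) (t : R).

Let p := grad phi x.
Let P := enorm p.
Let v := P^-1 *: p.
Let C := Cx phi x eta.
Let Hx := hess phi x.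
Let q := dot (v *m Hx) v.
Let w := sup [set opnorm (hess phi y - hess phi x) | y in eball x eps].

Let P0 : 0 < P. Proof. exact: enorm_gt0. Qed.
Let v1 : enorm v = 1.
Proof. by rewrite /v enormZ ger0_norm ?invr_ge0 ?enorm_ge0// mulVf// gt_eqF. Qed.
Let vN1 : enorm (- v) = 1. Proof. by rewrite enormN. Qed.
Let pE : p = P *: v. Proof. by rewrite /v scalerA mulfV ?gt_eqF// scale1r. Qed.
Let q0 : 0 < 2 - 2 * s. Proof. by have := s_lt; lra. Qed.
Let s21 : 0 < 2 * s - 1. Proof. by have := s_gt; lra. Qed.
Let s0 : 0 < s. Proof. by have := s_gt; lra. Qed.

Let phi_bounded : exists M, forall z, `|phi z| <= M. Proof. by case: H. Qed.

Let mline y : measurable_fun [set: R] (fun t : R => phi (x + t *: y)).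
Proof. by apply: measurable_fun_line; case: H. Qed.

Let dphi z : eball x eta z -> differentiable phi z.
Proof. by case: H => _ _ [+ _ _ _ _] _; apply. Qed.

Let dphi2 i z : eball x eta z -> differentiable ('D_(ebasis R i) phi) z.
Proof. by case: H => _ _ [_ + _ _ _] _; apply. Qed.

Let ball_center (r : R) : 0 < r -> eball x r x.
Proof. by rewrite /eball/= subrr enorm0. Qed.

Let hessC z : eball x eta z -> opnorm (hess phi z) <= 2 * C.
Proof.
move=> xz; rewrite /C /Cx mulrA mulfV// mul1r.
have [K HK] := opnorm_hess_bounded H.
apply: ub_le_sup; last by exists z.
by exists K => _ [u xu <-]; exact: HK.
Qed.

Let C0 : 0 <= C.
Proof.
by have := le_trans (opnorm_ge0 _) (hessC (ball_center eta0)); rewrite pmulr_rge0.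
Qed.

Let hessw z : eball x eps z -> opnorm (hess phi z - hess phi x) <= w.
Proof.
move=> xz; apply: ub_le_sup; last by exists z.
exists (2 * C + 2 * C) => _ [u xu <-].
apply: le_trans (opnormB_le _ _) _; apply: lerD; apply: hessC.
  exact: lt_trans eps_eta.
exact: ball_center.
Qed.

Let w0 : 0 <= w.
Proof. exact: le_trans (opnorm_ge0 _) (hessw (ball_center eps0)). Qed.

Let first_order t y z : 0 < t -> t < eta -> enorm y <= 1 -> enorm z <= 1 ->
  `|phi (x + t *: y) - phi (x + t *: z) - t * dot p (y - z)|
   <= 2 * C * t ^+ 2 * enorm (y - z).
Proof.
move=> t0 te y1 z1.
have nt u : enorm u <= 1 -> enorm (t *: u) <= t.
  by move=> u1; rewrite enormZ gtr0_norm// ler_piMr// ltW.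
have := first_order_two_points dphi dphi2 hessC te (nt _ y1) (nt _ z1).
rewrite -scalerBr dotZr enormZ (gtr0_norm t0).
by rewrite (mulrA (2 * C * t)) -(mulrA (2 * C)) -expr2.
Qed.

Let pair y yt t := Lphi phi x (t *: y) (t *: yt).

Let mpair y yt : measurable_fun [set: R] (pair y yt).
Proof.
apply: measurable_funB; last exact: measurable_cst.
apply: measurable_funD; first exact: mline.
have -> : (fun t : R => phi (x - t *: yt)) = (fun t : R => phi (x + t *: - yt)).
  by apply/funext => t; rewrite scalerN.
exact: mline.
Qed.

Let pair_bounded y yt : exists M, forall t, `|pair y yt t| <= M.
Proof.
have [M HM] := phi_bounded; exists (M + M + 2 * M) => t.
rewrite /pair /Lphi; apply: le_trans (ler_normB _ _) _; apply: lerD.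
  by apply: le_trans (ler_normD _ _) _; apply: lerD.
by rewrite normrM ger0_norm// ler_wpM2l.
Qed.

(** The sign of the slope p.(y - yt) decides whether the singular integral is -oo or +oo; on the
    diagonal it is 0 and the integrand is O(t^2). *)
Let pair_first_order y yt t : enorm y = 1 -> enorm yt = 1 -> 0 < t -> t < eta ->
  `|pair y yt t - dot p (y - yt) * t| <= 4 * C * t ^+ 2.
Proof.
move=> y1 yt1 t0 te.
have n0 : enorm (0 : 'rV[R]_N) <= 1 by rewrite enorm0.
have h1 : enorm y <= 1 by rewrite y1.
have h2 : enorm (- yt) <= 1 by rewrite enormN yt1.
have := first_order t0 te h1 n0; have := first_order t0 te h2 n0.
rewrite scaler0 addr0 !subr0 enormN y1 yt1 !mulr1 scalerN /pair /Lphi.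
rewrite dotDr !dotNr !ler_norml => /andP[a1 a2] /andP[b1 b2].
by apply/andP; split; lra.
Qed.

Let pair_diag_second_order t : 0 < t -> t < eps ->
  `|pair v v t - q * t ^+ 2| <= w * t ^+ 2.
Proof.
move=> t0 te.
have n1 : enorm (t *: v) < eps by rewrite enormZ v1 mulr1 gtr0_norm.
have n2 : enorm (- (t *: v)) < eps by rewrite enormN.
have := second_order_point dphi dphi2 (ltW eps_eta) n1 hessw.
have := second_order_point dphi dphi2 (ltW eps_eta) n2 hessw.
rewrite !enormN enormZ v1 mulr1 (gtr0_norm t0) /pair /Lphi.
rewrite mulNmx -scalemxAl !dotE -/p -/Hx -/q opprK.
rewrite !ler_norml => /andP[a1 a2] /andP[b1 b2].
have -> : q = P^-1 * dot (v *m Hx) p by rewrite /q {2}/v dotZr.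
by apply/andP; split; lra.
Qed.

Let pair_integral : exists L : R, mus_int0 s (pair v v) = (Cs s * L)%:E /\
  `|L - wint s `]eps, +oo[ (pair v v) - q * (eps `^ (2 - 2 * s) / (2 - 2 * s))|
     <= w * (eps `^ (2 - 2 * s) / (2 - 2 * s)).
Proof.
have [M HM] := pair_bounded v v.
have [t t0 te|L [LE HL]] := mus_int0_quadratic s_gt s_lt (mpair v v) HM eta0 (K := 4 * C).
  by have := pair_first_order v1 v1 t0 te; rewrite subrr dot0r mul0r subr0.
by exists L; split => //; apply: HL => // t; exact: pair_diag_second_order.
Qed.

Let dot_p_unit y : enorm y = 1 -> dot p y = P - P * enorm (y - v) ^+ 2 / 2.
Proof. by move=> y1; rewrite pE dotZl dot_unit// mulrBr mulr1 mulrA. Qed.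

Let dot_p_lt y : enorm y = 1 -> y != v -> dot p y < P.
Proof.
move=> y1 yv; rewrite dot_p_unit// gtrBl divr_gt0// mulr_gt0// exprn_gt0//.
by rewrite enorm_gt0// subr_eq0.
Qed.

Let dot_p_v : dot p v = P.
Proof. by rewrite dot_p_unit// subrr enorm0 expr0n/= mulr0 mul0r subr0. Qed.

(** (v, v) is a saddle point, since p.y < |p| for every other unit y. Answering y with yt = v gives
    -oo unless y = v, which bounds the supremum; starting from y = v every yt other than v gives
    +oo, which bounds the infimum. *)
Lemma LsE : exists L : R, Ls s phi x = (Cs s * L)%:E /\
  `|L - wint s `]eps, +oo[ (pair v v) - q * (eps `^ (2 - 2 * s) / (2 - 2 * s))|
     <= w * (eps `^ (2 - 2 * s) / (2 - 2 * s)).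
Proof.
have [L [LE HL]] := pair_integral; exists L; split => //.
apply/eqP; rewrite eq_le; apply/andP; split.
- apply: ge_ereal_sup => _ [y /= y1 <-].
  have [->|yv] := eqVneq y v.
    by rewrite -LE; apply: ereal_inf_lbound; exists v.
  apply: (@le_trans _ _ -oo%E); last exact: leNye.
  apply: ereal_inf_lbound; exists v => //.
  have [M HM] := pair_bounded y v.
  apply: (@mus_int0_Ny _ _ s_gt s_lt _ M (P - dot p y) (4 * C) eta (mpair y v) HM eta0).
    by rewrite subr_gt0 dot_p_lt.
  move=> t t0 te; have := pair_first_order y1 v1 t0 te.
  by rewrite dotDr dotNr dot_p_v ler_norml /pair => /andP[_]; lra.
- apply: (@le_trans _ _ (ereal_inf [set mus_int0 s (pair v yt) | yt in @usphere R N])).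
    apply/ereal_infP => _ [yt /= yt1 <-].
    have [->|ytv] := eqVneq yt v; first by rewrite LE.
    have [M HM] := pair_bounded v yt.
    rewrite (@mus_int0_y _ _ s_gt s_lt _ M (P - dot p yt) (4 * C) eta (mpair v yt) HM eta0).
    + exact: leey.
    + by rewrite subr_gt0 dot_p_lt.
    + move=> t t0 te; have := pair_first_order v1 yt1 t0 te.
      by rewrite dotDr dotNr dot_p_v ler_norml /pair => /andP[+ _]; lra.
  by apply: ereal_sup_ubound; exists v.
Qed.

Let line y t := phi (x + t *: y).
Let F y := mus_avg s eps (line y).
Let k0 := 2 * s * eps `^ (2 * s).
(** [PP] and [Q] are the integrals of t and t^2 against t^(-1-2s) over (eps, eta), and [W] is that
    of 1 + t over (eta, oo). *)
Let PP := (eps `^ (1 - 2 * s) - eta `^ (1 - 2 * s)) / (2 * s - 1).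
Let Q := (eta `^ (2 - 2 * s) - eps `^ (2 - 2 * s)) / (2 - 2 * s).
Let W := eta `^ (- (2 * s)) / (2 * s) + eta `^ (1 - 2 * s) / (2 * s - 1).
Let A := Aeps_const s phi x eta eps.
Let om := omega phi x eta.
Let G := 2 * C * Q * A + 2 * W * om A.

Let k0_gt0 : 0 < k0. Proof. by rewrite /k0 !mulr_gt0// powR_gt0. Qed.

Let pow_gt : eta `^ (1 - 2 * s) < eps `^ (1 - 2 * s).
Proof.
rewrite -(opprB (2 * s)) !powRN ltf_pV2 ?posrE ?powR_gt0//.
by rewrite gt0_ltr_powR ?nnegrE ?(ltW eps0) ?(ltW eta0).
Qed.

Let PP_gt0 : 0 < PP. Proof. by rewrite divr_gt0// subr_gt0. Qed.

Let Q_ge0 : 0 <= Q.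
Proof.
rewrite divr_ge0 ?(ltW q0)// subr_ge0.
by rewrite ge0_ler_powR ?nnegrE ?(ltW q0) ?(ltW eps0) ?(ltW eta0) ?(ltW eps_eta).
Qed.

Let W_ge0 : 0 <= W.
Proof. by rewrite addr_ge0// divr_ge0 ?powR_ge0// ?mulr_ge0// ltW. Qed.

Let iline y : wintegrable s `]eps, +oo[ (line y).
Proof.
have [M HM] := phi_bounded.
by apply: (wintegrable_bounded s_gt eps0 (mline y) (M := M)) => t; exact: HM.
Qed.

Let FE y : F y = k0 * wint s `]eps, +oo[ (line y).
Proof. exact: mus_avgE. Qed.

Let F_bounded : exists M, forall y, `|F y| <= M.
Proof.
have [M HM] := phi_bounded.
have [i1 _] := wint_tail1 s_gt eps0.
exists (k0 * (M * wint s `]eps, +oo[ (fun=> 1))) => y.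
rewrite FE normrM (gtr0_norm k0_gt0) ler_wpM2l ?(ltW k0_gt0)//.
have mI : measurable (`]eps, +oo[ : set R) by exact: measurable_itv.
rewrite ler_norml -mulNr -!wintZ//; apply/andP; split; apply: wint_le => //.
- exact: wintegrableZ.
- by move=> t _; have := HM (x + t *: y); rewrite mulr1 ler_norml => /andP[].
- exact: wintegrableZ.
- by move=> t _; have := HM (x + t *: y); rewrite mulr1 ler_norml => /andP[].
Qed.

Let om_ge0 a : 0 <= a -> 0 <= om a.
Proof. by have [M HM] := phi_bounded; exact: omega_ge0 HM a. Qed.

Let om_le a b : 0 <= a -> a <= b -> om a <= om b.
Proof. by have [M HM] := phi_bounded; exact: le_omega HM a b. Qed.

(** Both entries are ratios of these integrals; 16 becomes 32 because [Q] carries the factor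
    1/(2(1-s)). *)
Let AE : A = Num.max (32 * C * Q / (P * PP))
  (sup [set a | 0 <= a <= 2 /\ a ^+ 2 <= 8 * om a / P * (W / PP)]).
Proof.
have n1 : s != 0 by rewrite gt_eqF.
have n2 : 2 * s - 1 != 0 by rewrite gt_eqF.
have n3 : 1 - s != 0 by rewrite subr_eq0 gt_eqF.
have n4 : eps `^ (1 - 2 * s) - eta `^ (1 - 2 * s) != 0 by rewrite gt_eqF// subr_gt0.
have n5 : P != 0 by rewrite gt_eqF.
rewrite /A /Aeps_const /kappa -/p -/P -/C; congr Num.max.
  rewrite /Q /PP.
  have -> : 2 - 2 * s = 2 * (1 - s) by ring.
  by field; rewrite n5 n4 n2 n3.
have -> : ((2 * s - 1) / (2 * s) * eta `^ (- (2 * s)) + eta `^ (1 - 2 * s)) /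
   (eps `^ (1 - 2 * s) - eta `^ (1 - 2 * s)) = W / PP.
  by rewrite /W /PP; field; rewrite n1 n2 n4.
by [].
Qed.

Let gain d := direction_gain_le (p := P) (C := C) P0 C0 PP_gt0 Q_ge0 W_ge0 (om := om) (d := d).

Let I02 : 0 <= (0 : R) <= 2. Proof. by rewrite lexx ler0n. Qed.

Let A_ge0 : 0 <= A.
Proof. by have [A_0 _ _] := gain I02 om_ge0 om_le AE. Qed.

Let G_ge0 : 0 <= G.
Proof. by have [_ G_0 _] := gain I02 om_ge0 om_le AE. Qed.

(** The sign sg treats at once the supremum, compared with v, and the infimum, compared with -v. *)
Let direction_gain (sg : R) y : (1 < N)%N -> sg = 1 \/ sg = -1 -> enorm y = 1 ->
  sg * (wint s `]eps, +oo[ (line y) - wint s `]eps, +oo[ (line (sg *: v))) <= G.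
Proof.
move=> N1 sg1 y1.
have sg2 : sg * sg = 1 by case: sg1 => ->; ring.
have nsg : `|sg| = 1 by case: sg1 => ->; rewrite ?normrN1 ?normr1.
have vs1 : enorm (sg *: v) = 1 by rewrite enormZ nsg v1 mulr1.
have [M HM] := phi_bounded.
have mI : measurable (`]eps, +oo[ : set R) by exact: measurable_itv.
pose g t := sg * (line y t + -1 * line (sg *: v) t).
have ivs : wintegrable s `]eps, +oo[ (fun t => -1 * line (sg *: v) t).
  exact: wintegrableZ.
have <- : wint s `]eps, +oo[ g =
    sg * (wint s `]eps, +oo[ (line y) - wint s `]eps, +oo[ (line (sg *: v))).
  by rewrite /g wintZ ?wintD ?wintZ ?mulN1r//; exact: wintegrableD.
have absg (X : R) : sg * X <= `|X|.
  by apply: le_trans (ler_norm _) _; rewrite normrM nsg mul1r.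
set d := enorm (y - sg *: v).
have mg : measurable_fun [set: R] g.
  apply: measurable_funM => //; apply: measurable_funD; first exact: mline.
  by apply: measurable_funM => //; exact: mline.
have gM t : `|g t| <= M + M.
  rewrite /g normrM nsg mul1r mulN1r.
  by apply: le_trans (ler_normB _ _) _; apply: lerD; exact: HM.
have d0 : 0 <= d by exact: enorm_ge0.
have d2 : d <= 2.
  by apply: le_trans (ler_enormD _ _) _; rewrite enormN y1 vs1.
(* Since sg^2 = 1, either sign gives sg p.y = |p|(1 - d^2/2), hence the same linear loss. *)
have dp : sg * dot p (y - sg *: v) = - (P * d ^+ 2 / 2).
  have E : sg * dot v y = 1 - d ^+ 2 / 2 by rewrite -dotZl; exact: dot_unit.
  rewrite dotDr dotNr (dotZr sg p v) dot_p_v {1}pE (dotZl P v).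
  transitivity (P * (sg * dot v y) - sg * sg * P); first by ring.
  by rewrite E sg2; ring.
have H1 t : eps < t -> t < eta -> g t <= - (P * d ^+ 2 / 2) * t + 2 * C * d * t ^+ 2.
  move=> et te; have t0 : 0 < t by exact: lt_trans et.
  have y1' : enorm y <= 1 by rewrite y1.
  have vs1' : enorm (sg *: v) <= 1 by rewrite vs1.
  have := first_order t0 te y1' vs1'; rewrite -/d -/(line y t) -/(line (sg *: v) t).
  move=> /(le_trans (absg _)).
  rewrite mulrBr (mulrCA sg) dp /g mulN1r; lra.
have H2 t : eta < t -> g t <= 2 * om d * (1 + t).
  move=> et; have := omega_sphere x N0 eta0 HM N1 et y1 vs1.
  rewrite -/d -/om -/(line y t) -/(line (sg *: v) t).
  move=> /(le_trans (absg _)).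
  rewrite /g mulN1r; lra.
have dI : 0 <= d <= 2 by rewrite d0 d2.
have [_ _ +] := gain dI om_ge0 om_le AE; apply: le_trans.
exact: wint_tail_le mg gM eps0 eps_eta H1 H2.
Qed.

Let sup_inf_F : `|sup (F @` @usphere R N) + inf (F @` @usphere R N) - (F v + F (- v))|
  <= k0 * G.
Proof.
have [M HM] := F_bounded.
(* For [N = 1] the sphere is disconnected and has no chains, but it is {v, -v}. *)
have [N1|N1] := leqP N 1.
  rewrite (@sup_inf_pair _ _ F _ v (- v))//.
    by rewrite subrr normr0 mulr_ge0// ltW.
  move=> y y1; pose i0 := Ordinal N0.
  have i0E (i : 'I_N) : i = i0.
    by apply/val_inj => /=; have := leq_trans (ltn_ord i) N1; rewrite ltnS leqn0 => /eqP.
  have dE u : dot u u = u ord0 i0 ^+ 2.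
    rewrite /dot (bigD1 i0)//= big1 ?addr0 ?expr2// => i; by rewrite (i0E i) eqxx.
  have : y ord0 i0 ^+ 2 == v ord0 i0 ^+ 2 by rewrite -!dE -!sqr_enorm y1 v1.
  rewrite eqf_sqr => /orP[/eqP E|/eqP E]; [left|right];
    by apply/rowP => i; rewrite (i0E i) ?mxE E ?mxE.
apply: (sup_inf_near (M := M)) => // y y1; rewrite !FE -mulrBr ler_wpM2l ?(ltW k0_gt0)//.
- by have := direction_gain N1 (or_introl erefl) y1; rewrite mul1r scale1r.
- by have := direction_gain N1 (or_intror erefl) y1; rewrite mulN1r scaleN1r opprB.
Qed.

Let sup_inf_ball :
  `|sup (phi @` eball x eps) + inf (phi @` eball x eps) - 2 * phi x - eps ^+ 2 * q|
  <= w * eps ^+ 2 + eps ^+ 3 * opnorm Hx ^+ 2 / (2 * P).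
Proof.
have -> : phi @` eball x eps = [set phi (x + u) | u in [set u | enorm u < eps]].
  apply/seteqP; split => [_ [z xz <-]|_ [u /= ue <-]].
    by exists (z - x) => //; rewrite addrC subrK.
  by exists (x + u) => //; rewrite /eball/= addrC addKr.
have [M HM] := phi_bounded.
apply: (@sup_inf_on_ball _ _ (fun u => phi (x + u)) p v Hx (phi x) (opnorm Hx) eps w M eps0 v1 p0 pE) => //.
- by move=> a b; exact: ler_dot_mulmx.
- by move=> u ue; exact: (second_order_point dphi dphi2 (ltW eps_eta) ue hessw).
Qed.

Lemma Aeps_expansion :
  (`| (Aeps s eps phi x - phi x)%:E - ((cs s)^-1 * eps `^ (2 * s))%:E * Ls s phi x |
   <= (2 * eps `^ (2 * s) *
         (2 * s * Cx phi x eta * (eta `^ (2 - 2 * s) - eps `^ (2 - 2 * s))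
            * Aeps_const s phi x eta eps
          + (eta `^ (- (2 * s)) / 2 + s * eta `^ (1 - 2 * s) / (2 * s - 1))
            * (1 - s) * omega phi x eta (Aeps_const s phi x eta eps))
       + 2 * s * eps ^+ 3 * (opnorm (hess phi x) ^+ 2 / enorm (grad phi x))
       + s * eps ^+ 2 * sup [set opnorm (hess phi y - hess phi x) | y in eball x eps])%:E)%E.
Proof.
have [L [-> HL]] := LsE.
rewrite -EFinM -EFinB abse_EFin lee_fin.
rewrite -/C -/A -/p -/P -/Hx -/w -[omega _ _ _ _]/(om A).
have Cs0 := Cs_gt0 s_gt s_lt.
have s1 : 0 < 1 - s by rewrite subr_gt0.
have n1 : s != 0 by rewrite gt_eqF.
have n2 : 2 * s - 1 != 0 by rewrite gt_eqF.
have n3 : 1 - s != 0 by rewrite gt_eqF.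
set e2s := eps `^ (2 * s).
have e2s0 : 0 < e2s by exact: powR_gt0.
have -> : (cs s)^-1 * e2s * (Cs s * L) = s * (1 - s) * e2s * L.
  by rewrite /cs; field; rewrite n1 n3 gt_eqF.
(* The normalized integral of t^2 over (0, eps) is a multiple of eps^2, the order of the ball
   term. *)
have qq : e2s * (eps `^ (2 - 2 * s) / (2 - 2 * s)) = eps ^+ 2 / (2 * (1 - s)).
  rewrite mulrA /e2s -powRD; last by rewrite (gt_eqF eps0) implybT.
  rewrite addrC subrK powR_mulrn ?(ltW eps0)//; congr (_ / _); ring.
have [i1 w1] := wint_tail1 s_gt eps0.
have mI : measurable (`]eps, +oo[ : set R) by exact: measurable_itv.
have w1E : e2s * wint s `]eps, +oo[ (fun=> 1) = (2 * s)^-1.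
  by rewrite w1 powRN -/e2s mulVKf// gt_eqF.
set Ip := wint s `]eps, +oo[ (line v); set Im := wint s `]eps, +oo[ (line (- v)).
have ppE : wint s `]eps, +oo[ (pair v v) =
    Ip + Im + - (2 * phi x) * wint s `]eps, +oo[ (fun=> 1).
  rewrite -wintZ// -!wintD//; [|exact: wintegrableD|exact: wintegrableZ].
  by congr (wint s); apply/funext => t; rewrite /pair /Lphi /line scalerN mulr1.
have HS := sup_inf_F; have HB := sup_inf_ball.
set S1 := sup _ in HS; set S2 := inf _ in HS.
set S3 := sup _ in HB; set S4 := inf _ in HB.
have AepsE : Aeps s eps phi x = (1 - s) / 2 * (S1 + S2) + s / 2 * (S3 + S4).
  by rewrite /Aeps /Aeps_o -/S1 -/S2 -/S3 -/S4 mulrA.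
rewrite !FE -mulrDr -/Ip -/Im in HS.
rewrite ppE in HL; set D := L - _ - _ in HL.
have HL' : `|e2s * D| <= w * (eps ^+ 2 / (2 * (1 - s))).
  by rewrite normrM (gtr0_norm e2s0) -qq mulrCA ler_wpM2l// ltW.
have e2sD : e2s * D = e2s * L - e2s * (Ip + Im) + phi x / s - q * (eps ^+ 2 / (2 * (1 - s))).
  rewrite /D; set w1' := wint _ _ _ in w1E *; rewrite -qq.
  transitivity (e2s * L - e2s * (Ip + Im) + 2 * phi x * (e2s * w1')
    - q * (e2s * (eps `^ (2 - 2 * s) / (2 - 2 * s)))); first by ring.
  by rewrite w1E; congr (_ + _ - _); field.
set T1 := S1 + S2 - _ in HS; set T2 := S3 + S4 - _ - _ in HB.
(* In this identity the averages along v and -v, the values phi(x) and the terms in q of the three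
   errors cancel. *)
have -> : Aeps s eps phi x - phi x - s * (1 - s) * e2s * L =
    (1 - s) / 2 * T1 + s / 2 * T2 - s * (1 - s) * (e2s * D).
  rewrite e2sD AepsE /T1 /T2 /k0 -/e2s; field.
  by rewrite n1 n3.
have b1 : `|(1 - s) / 2 * T1| <= (1 - s) / 2 * (k0 * G).
  by rewrite normrM gtr0_norm ?divr_gt0// ler_wpM2l// divr_ge0// ltW.
have b2 : `|s / 2 * T2| <= s / 2 * (w * eps ^+ 2 + eps ^+ 3 * opnorm Hx ^+ 2 / (2 * P)).
  by rewrite normrM gtr0_norm ?divr_gt0// ler_wpM2l// divr_ge0// ltW.
have b3 : `|s * (1 - s) * (e2s * D)| <= s * (1 - s) * (w * (eps ^+ 2 / (2 * (1 - s)))).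
  by rewrite normrM gtr0_norm ?mulr_gt0// ler_wpM2l// mulr_ge0// ltW.
apply: le_trans (ler_normB _ _) _.
apply: le_trans (lerD (ler_normD _ _) (lexx _)) _.
apply: le_trans (lerD (lerD b1 b2) b3) _.
have c1 : (1 - s) / 2 * (k0 * G) = e2s * (s * C * (eta `^ (2 - 2 * s) - eps `^ (2 - 2 * s)) * A
   + 2 * (eta `^ (- (2 * s)) / 2 + s * eta `^ (1 - 2 * s) / (2 * s - 1)) * (1 - s) * om A).
  rewrite /k0 -/e2s /G /Q /W.
  have -> : 2 - 2 * s = 2 * (1 - s) by ring.
  by field; rewrite n1 n2 n3.
(* The ball and the singular part contribute (s/2) w eps^2 each, which add up to the last term of
   the bound. *)
have c3 : s * (1 - s) * (w * (eps ^+ 2 / (2 * (1 - s)))) = s / 2 * (w * eps ^+ 2).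
  by field.
rewrite c1 c3.
set Z := eta `^ (2 - 2 * s) - eps `^ (2 - 2 * s).
have Z0 : 0 <= Z.
  have -> : Z = (2 - 2 * s) * Q by rewrite /Q mulrC divfK// gt_eqF.
  by rewrite mulr_ge0// ltW.
have sC : 0 <= s * C by rewrite mulr_ge0 ?(ltW s0)//; exact: C0.
have sCZ : 0 <= s * C * Z by rewrite mulr_ge0.
have sCZA : 0 <= s * C * Z * A by rewrite mulr_ge0.
have u1 : 0 <= e2s * (s * C * Z * A) by rewrite mulr_ge0 ?(ltW e2s0).
have u2 : 0 <= s * (eps ^+ 3 * (opnorm Hx ^+ 2 / P)).
  by rewrite !mulr_ge0 ?exprn_ge0 ?invr_ge0 ?opnorm_ge0 ?(ltW s0) ?(ltW eps0) ?(ltW P0).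
have u3 : eps ^+ 3 * opnorm Hx ^+ 2 / (2 * P) = eps ^+ 3 * (opnorm Hx ^+ 2 / P) / 2.
  by field; rewrite gt_eqF.
(* The claimed bound has 4 times the term in C A and 8 times the cubic term obtained; [u1] and [u2]
   give the sign of the surplus. *)
rewrite u3; lra.
Qed.

End Expansion.

Theorem theorem1p2 (R : realType) (N : nat) (s : R) (x : 'rV[R]_N) (eta : R)
    (phi : 'rV[R]_N -> R) (eps : R) :
  (0 < N)%N -> 2^-1 < s -> s < 1 ->
  0 < eta -> hypH phi x eta -> grad phi x != 0 ->
  0 < eps -> eps < eta ->
  eps * opnorm (hess phi x) <= enorm (grad phi x) ->
  (`| (Aeps s eps phi x - phi x)%:E - ((cs s)^-1 * eps `^ (2 * s))%:E * Ls s phi x |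
   <= (2 * eps `^ (2 * s) *
         (2 * s * Cx phi x eta * (eta `^ (2 - 2 * s) - eps `^ (2 - 2 * s))
            * Aeps_const s phi x eta eps
          + (eta `^ (- (2 * s)) / 2 + s * eta `^ (1 - 2 * s) / (2 * s - 1))
            * (1 - s) * omega phi x eta (Aeps_const s phi x eta eps))
       + 2 * s * eps ^+ 3 * (opnorm (hess phi x) ^+ 2 / enorm (grad phi x))
       + s * eps ^+ 2 * sup [set opnorm (hess phi y - hess phi x) | y in eball x eps])%:E)%E.
Proof.
by move=> N0 s_gt s_lt eta0 H p0 eps0 eps_eta _; exact: Aeps_expansion.
Qed.
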